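(* Let $T$ be a bounded valence, bushy tree, let $G$ be a group, and let $G \times T \to T$ be a cobounded quasi-action of $G$ on $T$. Then there exist a bounded valence, bushy tree $T'$, an isometric action $G \times T' \to T'$, and a quasiconjugacy $f \colon T' \to T$ from the action of $G$ on $T'$ to the quasi-action of $G$ on $T$.
   Context: Trees are simplicial trees with the geodesic metric in which each edge has length $1$. A tree has bounded valence if its vertices have uniformly finite valence. A tree is bushy if each point is within a uniformly bounded distance of some vertex having at least $3$ unbounded complementary components. For $K \ge 1$, $C \ge 0$, a map $f\colon X \to Y$ of metric spaces is a $K,C$ quasi-isometry if $\frac1K d_X(x,y) - C \le d_Y(f(x),f(y)) \le K d_X(x,y) + C$ for all $x,y\in X$, and every point of $Y$ is within distance $C$ of $f(X)$. A quasi-action of a group $G$ on a metric space $X$ is a map $G\times X\to X$, $(g,x)\mapsto A_g(x) = g\cdot x$, for which there are constants $K\ge 1$, $C\ge 0$ such that each $A_g$ is a $K,C$ quasi-isometry of $X$, $A_{\mathrm{Id}}=\mathrm{Id}_X$, and $d(g\cdot(h\cdot x),(gh)\cdot x)\le C$ for all $g,h\in G$, $x\in X$. It is cobounded if there is a constant $R$ such that for each $x\in X$ every point of $X$ is within distance $R$ of $G\cdot x$. No assumption (topological, finite generation, or properness) is made on $G$ or the quasi-action. A quasiconjugacy between quasi-actions of $G$ on $X$ and on $Y$ is a quasi-isometry $f\colon X\to Y$ such that $d_Y(f(g\cdot x), g\cdot f(x))$ is bounded uniformly over $g\in G$, $x\in X$. *)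

(* Defs.v *)
From HB Require Import structures.
From mathcomp Require Import all_boot all_order all_algebra.
From mathcomp Require Import boolp classical_sets functions cardinality reals.
From mathcomp Require Import topology.

Set Implicit Arguments.
Unset Strict Implicit.
Unset Printing Implicit Defensive.

Import Order.TTheory GRing.Theory Num.Theory.

Local Open Scope classical_set_scope.
Local Open Scope card_scope.
Local Open Scope ring_scope.

(* The combinatorial structure of a simplicial tree; the metric space is the
   geometric realization [realization R T] below.  There is no finiteness
   assumption, and the decidability hidden in [choiceType] and [rel] is
   harmless classically. *)
Record simplicial_tree := SimplicialTree {
  vertex : choiceType;
  adj : rel vertex;
  adj_sym : symmetric adj;
  adj_irr : irreflexive adj;
  tree_nonempty : inhabited vertex;
  tree_connected : forall u v : vertex,
    exists2 p : seq vertex, path adj u p & last u p = v;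
  (* [ucycle] accepts [::] and backtracking 2-cycles [:: u; v], so "no
     circuits" means that no simple cycle has three or more vertices *)
  tree_acyclic : forall c : seq vertex, ucycle adj c -> (size c <= 2)%N
}.

Section Realization.
Variables (R : realType) (T : simplicial_tree).

Definition bary (u v : vertex T) (t : R) : vertex T -> R :=
  fun w => (1 - t) * (w == u)%:R + t * (w == v)%:R.

(* Points are given by barycentric coordinates; [u = v] gives the vertices
   (needed when the tree is reduced to a single vertex). *)
Record realization := Realization_point {
  bcoord : vertex T -> R;
  bcoordP : exists u v t,
    [/\ u = v \/ adj u v, 0 <= t <= 1 & bcoord = bary u v t]
}.

Lemma point_eq (x y : realization) : bcoord x = bcoord y -> x = y.
Proof.
by case: x y => [x Px] [y Py] /= xy; subst y; rewrite (Prop_irrelevance Px Py).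
Qed.

Lemma vertex_pointP (v : vertex T) : exists u u' t,
  [/\ u = u' \/ adj u u', 0 <= t <= 1 & bary v v 0 = bary u u' t].
Proof. by exists v, v, 0; split; [left|rewrite lexx ler01|]. Qed.

Definition vertex_point (v : vertex T) : realization :=
  Realization_point (vertex_pointP v).

Definition edge_segment (x y : realization) (l : R) : Prop :=
  exists u v s t, [/\ adj u v, 0 <= s <= 1, 0 <= t <= 1,
    bcoord x = bary u v s /\ bcoord y = bary u v t & l = `|s - t|].

Inductive polygonal_path : realization -> realization -> R -> Prop :=
| PolyNil x : polygonal_path x x 0
| PolyCons x y z l m : edge_segment x y l -> polygonal_path y z m ->
    polygonal_path x z (l + m).

(* The path metric for which every edge has length 1. *)
Definition geod_dist (x y : realization) : R :=
  inf [set l | polygonal_path x y l].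

Let edge_segment_sym x y l : edge_segment x y l -> edge_segment y x l.
Proof.
move=> [u [v [s [t [uv hs ht [ex ey] ->]]]]].
by exists u, v, t, s; split => //; rewrite distrC.
Qed.

Let edge_segment_ge x y l w :
  edge_segment x y l -> `|bcoord x w - bcoord y w| <= l.
Proof.
move=> [u [v [s [t [uv hs ht [-> ->] ->]]]]]; rewrite /bary.
have [->|_] := eqVneq w u.
  have -> : (u == v) = false.
    by apply/negbTE/eqP => e; rewrite -e adj_irr in uv.
  by rewrite !mulr1 !mulr0 !addr0 opprB addrC addrA subrK distrC.
rewrite !mulr0 !add0r -mulrBl normrM ler_piMr//.
by case: (w == v); rewrite ?normr1 ?normr0 ?ler01 ?lexx.
Qed.

Let poly_cat x y z l m : polygonal_path x y l -> polygonal_path y z m ->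
  polygonal_path x z (l + m).
Proof.
elim=> [{}x|{}x {}y y' l1 m1 s p IH] q; first by rewrite add0r.
by rewrite -addrA; apply: PolyCons s (IH q).
Qed.

Let poly_sym x y l : polygonal_path x y l -> polygonal_path y x l.
Proof.
elim=> [{}x|{}x {}y z l1 m1 s p IH]; first exact: PolyNil.
rewrite addrC -[l1]addr0; apply: poly_cat IH _.
exact: PolyCons (edge_segment_sym s) (PolyNil _).
Qed.

Let poly_ge x y l w : polygonal_path x y l -> `|bcoord x w - bcoord y w| <= l.
Proof.
elim=> [{}x|{}x {}y z l1 m1 s p IH]; first by rewrite subrr normr0.
have -> : bcoord x w - bcoord z w =
  (bcoord x w - bcoord y w) + (bcoord y w - bcoord z w) by rewrite addrA subrK.
by rewrite (le_trans (ler_normD _ _))// lerD// edge_segment_ge.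
Qed.

Let poly_ge0 x y l : polygonal_path x y l -> 0 <= l.
Proof.
case: (tree_nonempty T) => w /(poly_ge w); exact: le_trans.
Qed.

Let bary0 (u v : vertex T) : bary u v 0 = bcoord (vertex_point u).
Proof.
by apply/funext => w; rewrite /= /bary !mul0r.
Qed.

Let bary1 (u v : vertex T) : bary u v 1 = bcoord (vertex_point v).
Proof.
by apply/funext => w; rewrite /= /bary subrr subr0 !mul0r add0r addr0.
Qed.

Let unit0 : 0 <= (0 : R) <= 1. Proof. by rewrite lexx ler01. Qed.
Let unit1 : 0 <= (1 : R) <= 1. Proof. by rewrite lexx ler01. Qed.

Let poly_vertices u v : exists l,
  polygonal_path (vertex_point u) (vertex_point v) l.
Proof.
have [p] := tree_connected u v.
elim: p u => [u _ <-|w p IH u /= /andP[uw] /IH pw /pw [l hl]].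
  by exists 0; exact: PolyNil.
exists (`|0 - 1| + l); apply: PolyCons hl.
by exists u, w, 0, 1; split => //; rewrite bary0 bary1.
Qed.

Let poly_to_vertex x : exists u l, polygonal_path x (vertex_point u) l.
Proof.
have [u [v [t [uv ht ex]]]] := bcoordP x; exists u.
case: uv => [e|uv]; last first.
  exists (`|t - 0| + 0); apply: PolyCons (PolyNil _).
  by exists u, v, t, 0; split => //; rewrite bary0.
exists 0; suff -> : x = vertex_point u by exact: PolyNil.
apply: point_eq; rewrite ex -e; apply/funext => w.
by rewrite /= /bary -!mulrDl subrK subr0 addr0.
Qed.

Let poly_ex x y : exists l, polygonal_path x y l.
Proof.
have [u [l xu]] := poly_to_vertex x; have [v [m yv]] := poly_to_vertex y.
have [k uv] := poly_vertices u v.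
by exists (l + (k + m)); apply: poly_cat xu (poly_cat uv (poly_sym yv)).
Qed.

Let poly_inf x y : has_inf [set l | polygonal_path x y l].
Proof. by split; [exact: poly_ex | exists 0 => l /poly_ge0]. Qed.

Let geod_dist_le x y l : polygonal_path x y l -> geod_dist x y <= l.
Proof. by move=> p; apply: ge_inf => //; case: (poly_inf x y). Qed.

Let geod_dist_ge x y b : (forall l, polygonal_path x y l -> b <= l) ->
  b <= geod_dist x y.
Proof. by move=> h; apply: lb_le_inf => //; exact: poly_ex. Qed.

Let geod_distxx x : geod_dist x x = 0.
Proof.
apply/eqP; rewrite eq_le geod_dist_le ?geod_dist_ge//=; last exact: PolyNil.
by move=> l /poly_ge0.
Qed.

Let geod_dist_positivity x y : geod_dist x y = 0 -> x = y.
Proof.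
move=> d0; apply: point_eq; apply/funext => w; apply/eqP.
rewrite -subr_eq0 -normr_le0 -d0; apply: geod_dist_ge => l; exact: poly_ge.
Qed.

Let geod_dist_sym x y : geod_dist x y = geod_dist y x.
Proof.
by apply/eqP; rewrite eq_le; apply/andP; split;
  apply: geod_dist_ge => l /poly_sym /geod_dist_le.
Qed.

Let geod_dist_triangle y x z :
  geod_dist x z <= geod_dist x y + geod_dist y z.
Proof.
rewrite -lerBlDr; apply: geod_dist_ge => l xy; rewrite lerBlDr -lerBlDl.
apply: geod_dist_ge => m yz; rewrite lerBlDl; apply: geod_dist_le.
exact: poly_cat xy yz.
Qed.

HB.instance Definition _ := gen_eqMixin realization.
HB.instance Definition _ := gen_choiceMixin realization.
HB.instance Definition _ := isMetric.Build R realization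
  geod_distxx geod_dist_positivity geod_dist_sym geod_dist_triangle.

End Realization.

Section Trees.
Variables (R : realType) (T : simplicial_tree).

Definition bounded_valence : Prop :=
  exists N : nat, forall v : vertex T, [set w | adj v w] #<= `I_N.

Definition metric_bounded (X : metricType R) (A : set X) : Prop :=
  exists M : R, forall x y, A x -> A y -> mdist x y <= M.

Definition unbounded_complementary_components (v : vertex T) :
    set (set (realization R T)) :=
  [set C | (exists2 x, x <> vertex_point R v &
              C = connected_component (~` [set vertex_point R v]) x) /\
           ~ metric_bounded C].

Definition bushy : Prop :=
  exists D : R, forall x : realization R T, exists2 v : vertex T,
    `I_3 #<= unbounded_complementary_components v &
    mdist x (vertex_point R v) <= D.

End Trees.

Section QuasiActions.
Variable R : realType.

Definition KC_quasi_isometry (X Y : metricType R) (K C : R) (f : X -> Y) :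
    Prop :=
  (forall x y, K^-1 * mdist x y - C <= mdist (f x) (f y) <= K * mdist x y + C)
  /\ (forall y, exists x, mdist y (f x) <= C).

Definition quasi_isometry (X Y : metricType R) (f : X -> Y) : Prop :=
  exists K C : R, [/\ 1 <= K, 0 <= C & KC_quasi_isometry K C f].

Variable G : groupType.

Definition quasi_action (X : metricType R) (A : G -> X -> X) : Prop :=
  exists K C : R, [/\ 1 <= K, 0 <= C,
    forall g, KC_quasi_isometry K C (A g),
    forall x, A 1%g x = x &
    forall g h x, mdist (A g (A h x)) (A (g * h)%g x) <= C].

Definition cobounded (X : metricType R) (A : G -> X -> X) : Prop :=
  exists D : R, forall x y, exists g, mdist y (A g x) <= D.

(* Surjectivity of each [A g] follows from the two action laws. *)
Definition isometric_action (X : metricType R) (A : G -> X -> X) : Prop :=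
  [/\ forall x, A 1%g x = x,
      forall g h x, A (g * h)%g x = A g (A h x) &
      forall g x y, mdist (A g x) (A g y) = mdist x y].

Definition quasiconjugacy (X Y : metricType R)
    (A : G -> X -> X) (B : G -> Y -> Y) (f : X -> Y) : Prop :=
  quasi_isometry f /\
  exists D : R, forall g x, mdist (f (A g x)) (B g (f x)) <= D.

End QuasiActions.

(* Main.v *)
(* Let x0 be a branch vertex of T.  Only finitely many cosets of the subgroup of
   G fixing, up to finite sets, three half-trees at x0 move x0 into a given ball,
   so these cosets form a locally finite G-set W with a coarsely equivariant map
   to T: on W the quasi-action has become an action, by automorphisms of a graph.
   Ultrafilters on W serve as ends.  Among the cuts of minimum edge boundary
   separating two ultrafilters, choose those crossing as few other minimum cuts
   as possible; by submodularity the chosen cuts are pairwise nested (Dunwoody),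
   so they are the oriented edges of a tree T' on which G acts.
   Since W looks like a tree, a minimum cut has a boundary of bounded diameter.
   The positions in T of the cuts incident to one vertex of T' are coarsely dense
   on the geodesics between them, coarsely homogeneous under the vertex stabilizer,
   and have at most one end, because the chosen cuts separate all ends of T; hence
   they form a bounded set, and T' is quasi-isometric to T. *)
Require Import Defs.
From HB Require Import structures.
From mathcomp Require Import all_boot all_order all_algebra finmap zify ring lra.
From mathcomp Require Import boolp classical_sets functions cardinality reals.
From mathcomp Require Import topology normedtype.

Set Implicit Arguments.
Unset Strict Implicit.
Unset Printing Implicit Defensive.

Local Open Scope classical_set_scope.

(** * The combinatorial metric of a tree *)

(** Since nothing is assumed about [G], an orbit may meet a ball infinitely often, and no Cayley
    graph of [G] is available to be cut. What [G] does act on exactly is the set of half-trees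
    modulo finite sets: the error of a quasi-action is bounded, so it alters a half-tree only near
    its edge. This is why stabilizers are taken modulo finite sets. Three half-trees are used
    because a remote vertex lies in at most one of them, and the other two look alike from there.
    Submodularity of the boundary count does not by itself make minimum cuts nested: the corners of
    two crossing cuts may merely be minimum cuts again. The number of crossings breaks the tie, as
    it drops strictly at the corners. To be usable it must be finite, and this is what bounded
    boundaries are for; they in turn need a cost bound common to all pairs of ends, although the
    minimum cost varies with the pair. That bound, like most later ones, is uniform because [G] is
    transitive on the cosets: a configuration is moved to a base point, where only finitely many
    exist. *)

Section TreeMetric.
Variable T : simplicial_tree.
Implicit Types (a b u v w : vertex T) (p : seq (vertex T)).

Lemma dist_subproof u v : exists n : nat,
  `[< exists2 p, path (@adj T) u p & last u p = v /\ size p = n >].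
Proof.
have [p up pv] := tree_connected u v.
by exists (size p); apply/asboolP; exists p.
Qed.

Definition dist u v : nat := ex_minn (dist_subproof u v).

Lemma dist_path u v :
  exists p, [/\ path (@adj T) u p, last u p = v & size p = dist u v].
Proof.
rewrite /dist; case: ex_minnP => n /asboolP [p up [pv pn]] _.
by exists p; split.
Qed.

Lemma dist_le u p : path (@adj T) u p -> dist u (last u p) <= size p.
Proof.
move=> up; rewrite /dist; case: ex_minnP => n _; apply.
by apply/asboolP; exists p.
Qed.

Lemma dist0 u : dist u u = 0.
Proof. by apply/eqP; rewrite -leqn0 (@dist_le u [::]). Qed.

Lemma dist_eq0 u v : dist u v = 0 -> u = v.
Proof.
by have [p [_ <- <-]] := dist_path u v; case: p.
Qed.

Lemma dist_adj u v : adj u v -> dist u v = 1.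
Proof.
move=> uv; have := @dist_le u [:: v]; rewrite /= uv => /(_ isT).
case E : (dist u v) => [|[|n]] //.
by move: (dist_eq0 E) uv => ->; rewrite adj_irr.
Qed.

Lemma adj_dist u v : dist u v = 1 -> adj u v.
Proof.
have [p [up <- <-]] := dist_path u v.
by case: p up => [|x [|]]//= /andP[].
Qed.

Lemma dist_sym u v : dist u v = dist v u.
Proof.
suff H x y : dist x y <= dist y x by apply/eqP; rewrite eqn_leq !H.
have [p [yp <- <-]] := dist_path y x.
have e : last (last y p) (rev (belast y p)) = y.
  by case: p yp => //= z p _; rewrite rev_cons last_rcons.
rewrite -(size_belast y p) -(size_rev (belast y p)) -{2}e; apply: dist_le.
by rewrite rev_path; under eq_path => z w do rewrite adj_sym.
Qed.

Lemma dist_tri v u w : dist u w <= dist u v + dist v w.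
Proof.
have [p [up pv <-]] := dist_path u v; have [q [vq qw <-]] := dist_path v w.
rewrite -size_cat -qw -pv -last_cat; apply: dist_le.
by rewrite cat_path up pv.
Qed.

Lemma dist_mid u v i : i <= dist u v ->
  exists2 w, dist u w = i & dist w v = dist u v - i.
Proof.
have [p [up pv ps]] := dist_path u v; rewrite -ps => ip.
move: up pv; rewrite -{1 2}(cat_take_drop i p) cat_path last_cat.
move=> /andP[up1 up2] pv; exists (last u (take i p)).
  have h1 := dist_le up1; have h2 := dist_le up2.
  have h3 := dist_tri (last u (take i p)) u v.
  by rewrite pv size_drop in h2; rewrite size_takel // in h1; lia.
have h1 := dist_le up1; have h2 := dist_le up2.
have h3 := dist_tri (last u (take i p)) u v.
by rewrite pv size_drop in h2; rewrite size_takel // in h1; lia.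
Qed.

(** For adjacent [a] and [b] this is the component of [b] after removal of the edge; [halfC] shows
    that no vertex is equidistant from both ends. *)
Definition half a b : set (vertex T) := [set v | dist v b < dist v a].

Lemma geodesic_path u v : exists p, [/\ path (@adj T) u p, last u p = v, uniq (u :: p) &
  forall z, z \in u :: p -> dist u z + dist z v = dist u v].
Proof.
have [p [up pv ps]] := dist_path u v.
have H z : z \in u :: p -> dist u z + dist z v = dist u v.
  move=> zp; case/splitPl: zp up pv ps => p1 p2 p1z.
  rewrite cat_path last_cat p1z size_cat => /andP[up1 zp2] p2v.
  have := dist_le up1; have := dist_le zp2; rewrite p1z p2v.
  by have := dist_tri z u v; lia.
case/shortenP: up pv => q uq uniq_q sub qv.
exists q; split => // z; rewrite inE => /orP[/eqP->|zq].
  by rewrite dist0.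
by apply: H; rewrite inE (sub _ zq) orbT.
Qed.

(** Geodesics from [b] to [v] and from [w] to [a] stay on their own sides, so with the two edges
    they form a simple cycle. Acyclicity allows only two vertices on it, hence both geodesics are
    trivial. *)
Lemma half_edge a b v w : adj a b -> adj v w -> half a b v -> ~ half a b w ->
  v = b /\ w = a.
Proof.
rewrite /half /= => ab vw vH wH.
have [p [bp pv up Hp]] := geodesic_path b v.
have [q [wq qa uq Hq]] := geodesic_path w a.
have pH z : z \in b :: p -> dist z b < dist z a.
  move/Hp; have := dist_tri z v a.
  by rewrite (dist_sym b z) (dist_sym b v) (dist_sym z v); lia.
have qH z : z \in w :: q -> ~ dist z b < dist z a.
  by move/Hq => h1 h2; apply: wH; have := dist_tri z w b; lia.
have : ucycle (@adj T) ((b :: p) ++ (w :: q)).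
  apply/andP; split.
    rewrite /= rcons_path cat_path /= bp pv vw wq /= last_cat /= qa.
    by [].
  rewrite cat_uniq up uq andbT andTb; apply/hasPn => z zq.
  by apply/negP => /pH; apply: qH.
move/tree_acyclic; rewrite size_cat /=.
by case: p q pv qa {bp up Hp pH wq uq Hq qH} => [|? ?] [|? ?] /=; try lia; move=> -> ->.
Qed.

Lemma half_cross a b v w : adj a b -> half a b v -> ~ half a b w ->
  dist v w = dist v b + 1 + dist a w.
Proof.
move=> ab; move E : (dist v w) => n; elim: n v E => [|n IH] v E vH wH.
  by move: (dist_eq0 E) vH => ->.
have [|z vz zw] := @dist_mid v w 1; first by lia.
rewrite E /= in zw.
have [zH|zH] := pselect (half a b z).
  have e : n = dist z b + 1 + dist a w by apply: IH => //; lia.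
  have h1 := dist_tri z v b; have h2 := dist_tri b v w.
  have h3 := dist_tri a b w; have h5 := dist_adj ab.
  by rewrite (dist_sym a b) in h5; lia.
have [-> <-] := half_edge ab (adj_dist vz) vH zH.
by rewrite dist0; lia.
Qed.

Lemma halfC a b v : adj a b -> ~ half a b v <-> half b a v.
Proof.
move=> ab; split; last by rewrite /half /=; lia.
move=> vH; have bH : half a b b by rewrite /half /= dist0 dist_sym (dist_adj ab).
have := half_cross ab bH vH; rewrite dist0 /half /= (dist_sym b v) (dist_sym a v).
lia.
Qed.

Lemma half_apart a b c v : adj a b -> adj a c -> b <> c -> half a b v -> half a c v -> False.
Proof.
move=> ab ac bc vb vc.
have cb : ~ half a b c.
  rewrite /half /= (dist_sym c a) (dist_adj ac) => h.
  by apply: bc; apply/esym/dist_eq0; lia.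
have := half_cross ab vb cb; rewrite (dist_adj ac).
have := dist_tri b v a; have := dist_adj ab; move: vc vb.
by rewrite /half /= (dist_sym b a); lia.
Qed.

Lemma ball_finite v r : bounded_valence T -> finite_set [set w | dist v w <= r].
Proof.
move=> [N bv]; elim: r => [|r IH].
  apply: (@sub_finite_set _ _ [set v]) => // w /=.
  by rewrite leqn0 => /eqP /dist_eq0.
apply: (@sub_finite_set _ _ ([set w | dist v w <= r] `|`
   \bigcup_(z in [set w | dist v w <= r]) [set w | adj z w])).
  move=> w /= vw; have [h|h] := leqP (dist v w) r; [by left|right].
  have [|z vz zw] := @dist_mid v w r; first by lia.
  by exists z => /=; [lia|apply: adj_dist; lia].
rewrite finite_setU; split => //; apply: bigcup_finite => // z _.
by apply/finite_set_leP; exists N.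
Qed.

(** Combinatorial form of an unbounded complementary component of [v]; see [branchingP]. *)
Definition arm v w := adj v w /\ forall M, exists2 h, half v w h & M < dist v h.

Definition branching v := exists w1 w2 w3, [/\ w1 <> w2, w1 <> w3 & w2 <> w3] /\
  [/\ arm v w1, arm v w2 & arm v w3].

End TreeMetric.

Lemma dist_lipschitz (T T' : simplicial_tree) (f : vertex T -> vertex T') k :
  (forall u v, adj u v -> dist (f u) (f v) <= k) ->
  forall u v, dist (f u) (f v) <= k * dist u v.
Proof.
move=> fk u v; move E : (dist u v) => n; elim: n u E => [|n IH] u E.
  by rewrite (dist_eq0 E) dist0.
have [|w uw wv] := @dist_mid _ u v 1; first by lia.
rewrite mulnS; apply: leq_trans (dist_tri (f w) _ _) _; apply: leq_add.
  exact/fk/adj_dist.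
by apply: IH; lia.
Qed.

Lemma branching_isometry (T T' : simplicial_tree) (f : vertex T -> vertex T') v :
  (forall u w, dist (f u) (f w) = dist u w) -> branching v -> branching (f v).
Proof.
move=> iso [w1 [w2 [w3 [[w12 w13 w23] [a1 a2 a3]]]]].
have f_arm w : arm v w -> arm (f v) (f w).
  move=> [vw h]; split; first by apply: adj_dist; rewrite iso; exact: dist_adj.
  by move=> M; have [u hu Mu] := h M; exists (f u); rewrite /half /= !iso.
have f_inj u w : u <> w -> f u <> f w.
  by move=> uw e; apply: uw; apply: dist_eq0; rewrite -iso e dist0.
exists (f w1), (f w2), (f w3); split; first by split; exact: f_inj.
by split; exact: f_arm.
Qed.

(** * Sets located at a point of a tree *)

Lemma finite_set_inj {U X : Type} (S : set U) (P : set X) (f : U -> X) :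
  (forall x, S x -> P (f x)) ->
  (forall x y, S x -> S y -> f x = f y -> x = y) -> finite_set P -> finite_set S.
Proof.
move=> SP finj finP; have [[x0 Sx0]|S0] := pselect (S !=set0); last first.
  by rewrite (_ : S = set0) //; apply/seteqP; split => // x Sx; apply: S0; exists x.
have ch y : exists x, forall z, S z -> f z = y -> x = z.
  have [[x [Sx <-]]|N] := pselect (exists x, S x /\ f x = y).
    by exists x => z Sz fz; apply: finj.
  by exists x0 => z Sz fz; case: N; exists z.
have [g gP] := choice ch.
apply: (@sub_finite_set _ _ (g @` P)); last exact: finite_image.
by move=> x Sx; exists (f x); [exact: SP|exact: gP].
Qed.

Lemma finite_powerset {U : Type} (B : set U) :
  finite_set B -> finite_set [set A | A `<=` B].
Proof.
elim/Pchoice: U B => U B finB.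
apply: (@sub_finite_set _ _ ((fun X : {fset U} => [set` X]) @` [set` fpowerset (fset_set B)])).
  move=> A /= AB; exists (fset_set A); last first.
    by rewrite fset_setK //; apply: sub_finite_set finB.
  by rewrite /= fpowersetE -fset_set_sub // ; apply: sub_finite_set finB.
exact/finite_image/finite_fset.
Qed.

Lemma finite_bounded {U : Type} (S : set U) (f : U -> nat) :
  finite_set S -> exists N, forall x, S x -> f x <= N.
Proof.
elim/Pchoice: U S f => U S f /finite_seqP[s ->].
exists (\max_(x <- s) f x) => x /= xs.
by rewrite (big_rem x) //= leq_maxl.
Qed.

Section CoarseTree.
Variables (T : simplicial_tree) (W : Type) (pi : W -> vertex T) (D : nat).
Hypothesis coarsely_onto : forall t, exists u, dist t (pi u) <= D.

Definition between (t s t' : vertex T) := dist t s + dist s t' = dist t t'.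

(** Lifts to [W] of consecutive vertices of a geodesic are at most [D + 1 + D] apart, whence
    [D.*2.+1]; at some step the lift leaves [A]. *)
Lemma between_split (A : set W) t t' u u' :
  dist t (pi u) <= D -> dist t' (pi u') <= D -> A u -> ~ A u' ->
  exists s v w, [/\ between t s t', A v, ~ A w, dist s (pi v) <= D &
    dist (pi v) (pi w) <= D.*2.+1].
Proof.
move E : (dist t t') => n; elim: n t u E => [|n IH] t u E tu tu' Au Au'.
  rewrite -(dist_eq0 E) in tu' *; exists t, u, u'; split => //.
    by rewrite /between !dist0.
  by have := dist_tri t (pi u) (pi u'); rewrite (dist_sym (pi u) t); lia.
have [|s ts st'] := @dist_mid T t t' 1; first by lia.
have [u1 su1] := coarsely_onto s.
have [Au1|Au1] := pselect (A u1); last first.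
  exists t, u, u1; split => //; first by rewrite /between dist0.
  have := dist_tri t (pi u) (pi u1); have := dist_tri s t (pi u1).
  by rewrite (dist_sym (pi u) t); lia.
have [|s' [v [w [s'b Av Aw s'v vw]]]] := IH s u1 _ su1 tu' Au1 Au'; first by lia.
exists s', v, w; split => //; move: s'b; rewrite /between.
by have := dist_tri s t s'; have := dist_tri s' t t'; lia.
Qed.

(** Join the points of [W] at distance at most [D.*2.+1], a graph connected by [between_split]: the
    boundary of [A] in it lies in a ball around [c]. *)
Definition located c R (A : set W) := forall v w, A v -> ~ A w ->
  dist (pi v) (pi w) <= D.*2.+1 -> dist (pi v) c <= R /\ dist (pi w) c <= R.

Lemma locatedC c R A : located c R A -> located c R (~` A).
Proof.
move=> lA v w nAv nnAw vw; have Aw := contrapT nnAw.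
by have [] := lA w v Aw nAv; rewrite 1?dist_sym.
Qed.

Lemma located_split c R A t t' u u' : located c R A ->
  dist t (pi u) <= D -> dist t' (pi u') <= D -> A u -> ~ A u' ->
  exists2 s, between t s t' & dist s c <= R + D.
Proof.
move=> lA tu tu' Au Au'.
have [s [v [w [bs Av Aw sv vw]]]] := between_split tu tu' Au Au'.
exists s => //; have [vc _] := lA v w Av Aw vw.
by have := dist_tri (pi v) s c; lia.
Qed.

Lemma located_near c R A u u' : located c R A -> A u -> ~ A u' ->
  dist (pi u) c + dist c (pi u') <= dist (pi u) (pi u') + (R + D).*2.
Proof.
move=> lA Au Au'.
have [||s] := @located_split c R A (pi u) (pi u') u u' lA _ _ Au Au'; rewrite ?dist0 //.
rewrite /between => bs sc.
have := dist_tri s (pi u) c; have := dist_tri s c (pi u').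
by rewrite (dist_sym c s); lia.
Qed.

Lemma located_far c R A u s u1 : located c R A -> dist s (pi u1) <= D ->
  dist (pi u) s + dist s c = dist (pi u) c -> R + D < dist s c -> A u -> A u1.
Proof.
move=> lA su1 bs sc Au; apply: contrapT => Au1.
have [|s' bs' s'c] := @located_split c R A (pi u) s u u1 lA _ su1 Au Au1; rewrite ?dist0 //.
by have := dist_tri s' (pi u) c; move: bs'; rewrite /between; lia.
Qed.

(** Going from [pi u] towards [c] up to distance [R + D + 1], one meets a lift on the same side as
    [u]; it lies within [R + D + 1 + D] of [c]. So the trace on the ball determines the set. *)
Lemma located_ball_inj c R A B : located c R A -> located c R B ->
  A `&` [set u | dist (pi u) c <= R + D.*2.+1] =
  B `&` [set u | dist (pi u) c <= R + D.*2.+1] -> A = B.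
Proof.
suff H A' B' : located c R A' -> located c R B' ->
  A' `&` [set u | dist (pi u) c <= R + D.*2.+1] =
  B' `&` [set u | dist (pi u) c <= R + D.*2.+1] -> A' `<=` B'.
  by move=> lA lB e; apply/seteqP; split; apply: H.
move=> {A B} lA lB e u Au.
have [h|h] := leqP (dist (pi u) c) (R + D.*2.+1).
  have : (A' `&` [set u | dist (pi u) c <= R + D.*2.+1]) u by [].
  by rewrite e => -[].
have [|s us sc] := @dist_mid T (pi u) c (dist (pi u) c - (R + D).+1); first by lia.
have [u1 su1] := coarsely_onto s.
have bs : dist (pi u) s + dist s c = dist (pi u) c by lia.
have sc' : R + D < dist s c by lia.
have A1 := located_far lA su1 bs sc' Au.
have : (A' `&` [set u | dist (pi u) c <= R + D.*2.+1]) u1.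
  split => //=; have := dist_tri s (pi u1) c; rewrite (dist_sym (pi u1) s); lia.
rewrite e => -[B1 _]; apply: contrapT => Bu.
by apply: (located_far (locatedC lB) su1 bs sc' Bu).
Qed.

Hypothesis balls_finite : forall t r, finite_set [set u | dist (pi u) t <= r].

Lemma located_finite c R : finite_set [set A | located c R A].
Proof.
apply: (@finite_set_inj _ _ _ [set X | X `<=` [set u | dist (pi u) c <= R + D.*2.+1]]
  (fun A => A `&` [set u | dist (pi u) c <= R + D.*2.+1])).
- by move=> A _ u [].
- by move=> A B lA lB; apply: located_ball_inj lA lB.
- exact/finite_powerset/balls_finite.
Qed.

End CoarseTree.

(** * Crossing of located sets *)

Definition crossing {W : Type} (A B : set W) := [/\ A `&` B !=set0, A `&` ~` B !=set0,
   ~` A `&` B !=set0 & ~` A `&` ~` B !=set0].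

Section Crossing.
Variables (T : simplicial_tree) (W : Type) (pi : W -> vertex T) (D : nat).
Hypothesis coarsely_onto : forall t, exists u, dist t (pi u) <= D.

(** Some corner contains a point [v] that [A] separates from a lift of [b], and [B] from a lift of
    [a]. Then [a] is almost between [v] and [b], and [b] almost between [v] and [a]; the sum of the
    two estimates bounds the distance. *)
Lemma crossing_near a b R A B : located pi D a R A -> located pi D b R B ->
  crossing A B -> dist a b <= (R + D.*2).*2.
Proof.
move=> lA lB [AB ABc AcB AcBc].
have [ua aua] := coarsely_onto a; have [ub bub] := coarsely_onto b.
have [v vA vB] : exists2 v, (A v <-> ~ A ub) & (B v <-> ~ B ua).
  have [Au|Au] := pselect (A ub); have [Bu|Bu] := pselect (B ua).
  - by case: AcBc => v [/= ? ?]; exists v; tauto.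
  - by case: AcB => v [/= ? ?]; exists v; tauto.
  - by case: ABc => v [/= ? ?]; exists v; tauto.
  - by case: AB => v [/= ? ?]; exists v; tauto.
have near c S u u' : located pi D c R S -> (S u <-> ~ S u') ->
    dist (pi u) c + dist c (pi u') <= dist (pi u) (pi u') + (R + D).*2.
  move=> lS uu'; have [Su|Su] := pselect (S u).
    by apply: (located_near coarsely_onto lS) => //; tauto.
  by apply: (located_near coarsely_onto (locatedC lS)) => //=; tauto.
have h1 := near a A v ub lA vA; have h2 := near b B v ua lB vB.
have h3 := dist_tri b (pi v) (pi ub); have h4 := dist_tri a (pi v) (pi ua).
have h5 := dist_tri (pi ub) a b; have h6 := dist_tri (pi ua) b a.
have h7 := dist_sym (pi ub) b; have h8 := dist_sym (pi ua) a.
have h9 := dist_sym a b; lia.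
Qed.

End Crossing.

(** * Uncrossing of minimal cuts *)

Local Notation card S := #|`fset_set S|.

Lemma card_sub {U : choiceType} (S1 S2 : set U) :
  S1 `<=` S2 -> finite_set S2 -> card S1 <= card S2.
Proof.
move=> S12 f2; have f1 := sub_finite_set S12 f2.
by apply: fsubset_leq_card; rewrite -(fset_set_sub f1 f2).
Qed.

Lemma card_proper {U : choiceType} (S1 S2 : set U) x :
  S1 `<=` S2 -> finite_set S2 -> S2 x -> ~ S1 x -> card S1 < card S2.
Proof.
move=> S12 f2 x2 x1; have f1 := sub_finite_set S12 f2.
apply: fproper_ltn_card; rewrite fproperE; apply/andP; split.
  by rewrite -(fset_set_sub f1 f2).
by apply/negP; rewrite -(fset_set_sub f2 f1) => /(_ _ x2).
Qed.

Lemma card_submodular {U : choiceType} (S1 S2 S3 S4 : set U) :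
  S1 `|` S2 `<=` S3 `|` S4 -> S1 `&` S2 `<=` S3 `&` S4 ->
  finite_set S3 -> finite_set S4 -> card S1 + card S2 <= card S3 + card S4.
Proof.
move=> SU SI f3 f4; have fU : finite_set (S3 `|` S4) by rewrite finite_setU.
have := sub_finite_set SU fU; rewrite finite_setU => -[f1 f2].
rewrite -(cardfsUI (fset_set S1)) -(cardfsUI (fset_set S3)).
rewrite -!fset_setU // -!fset_setI //; apply: leq_add; apply: card_sub => //.
exact: finite_setIl.
Qed.

Lemma card_submodular_lt {U : choiceType} (S1 S2 S3 S4 : set U) x :
  S1 `|` S2 `<=` S3 `|` S4 -> S1 `&` S2 `<=` S3 `&` S4 ->
  finite_set S3 -> finite_set S4 -> S3 x -> ~ S1 x -> ~ S2 x ->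
  card S1 + card S2 < card S3 + card S4.
Proof.
move=> SU SI f3 f4 x3 x1 x2; have fU : finite_set (S3 `|` S4) by rewrite finite_setU.
have := sub_finite_set SU fU; rewrite finite_setU => -[f1 f2].
rewrite -(cardfsUI (fset_set S1)) -(cardfsUI (fset_set S3)).
rewrite -!fset_setU // -!fset_setI // -addSn; apply: leq_add; last first.
  by apply: card_sub => //; exact: finite_setIl.
by apply: (@card_proper _ _ _ x) => //; [left|case].
Qed.

(** * Ultrafilters as ends *)

Section Ultra.
Context {W : Type} {x : set (set W)} {xU : UltraFilter x}.

Lemma ultraC A : x (~` A) <-> ~ x A.
Proof.
split; last by move=> xA; have [] := in_ultra_setVsetC A xU.
by move=> h1 h2; have /filter_ex[? []] : x (A `&` ~` A) by exact: filterI.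
Qed.

Lemma ultraI A B : x (A `&` B) <-> x A /\ x B.
Proof.
split; last by case=> xA xB; exact: filterI.
by move=> xAB; split; apply: filterS xAB => u [].
Qed.

Lemma ultraU A B : x (A `|` B) <-> x A \/ x B.
Proof.
have -> : A `|` B = ~` (~` A `&` ~` B) by rewrite setCI !setCK.
rewrite ultraC ultraI !ultraC; have := EM (x A); have := EM (x B); tauto.
Qed.

Lemma ultra_disjoint A B : A `<=` ~` B -> x A -> ~ x B.
Proof. by move=> AB xA; apply/ultraC; exact: filterS xA. Qed.

End Ultra.

(** Refine the filter of sets containing all but finitely many points of [S]. *)
Lemma ultra_infinite {W : Type} (S : set W) : infinite_set S ->
  exists x : set (set W), [/\ UltraFilter x, x S & forall F, finite_set F -> ~ x F].
Proof.
move=> infS; pose F := [set A | finite_set (S `\` A)].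
have PF : ProperFilter F.
  split; first by rewrite /F /= setD0.
  split; rewrite /F /=; first by rewrite setDT; exact: finite_set0.
    move=> P Q fP fQ; apply: (@sub_finite_set _ _ ((S `\` P) `|` (S `\` Q))).
      by move=> u [Su /not_andP[]]; [left|right].
    by rewrite finite_setU.
  by move=> P Q PQ; apply: sub_finite_set => u [Su nQ]; split => // /PQ.
have [x [xU Fx]] := ultraFilterLemma PF; exists x; split => //.
  by apply: Fx; rewrite /F /= setDv; exact: finite_set0.
move=> E fE; rewrite -ultraC; apply: Fx; rewrite /F /= setDE setCK.
exact: finite_setIr.
Qed.

(** * Crossing and the corners of two sets *)

Section CrossingTheory.
Context {W : Type}.
Implicit Types A B C : set W.

Lemma crossing_sym A B : crossing A B -> crossing B A.
Proof. by rewrite /crossing !(setIC B) !(setIC (~` B)) => -[]. Qed.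

Lemma crossingCl A B : crossing A B -> crossing (~` A) B.
Proof. by rewrite /crossing setCK => -[]. Qed.

Lemma crossingCE A B : crossing (~` A) B <-> crossing A B.
Proof. by split => /crossingCl; rewrite ?setCK. Qed.

Lemma crossingCr A B : crossing A (~` B) <-> crossing A B.
Proof. by split => /crossing_sym/crossingCE/crossing_sym. Qed.

(** Take [v] outside both [A] and [B]. If [C] crossed neither, then whichever of [C] and its
    complement misses [v] would be contained in [A] and in [B], hence in the corner, contrary to [C]
    crossing the corner. *)
Lemma crossingI A B C : crossing A B -> crossing (A `&` B) C ->
  crossing A C \/ crossing B C.
Proof.
move=> [_ _ _ [v [/= vA vB]]] [[w1 [/= [A1 B1] C1]] [w2 [/= [A2 B2] C2]]].
move=> [w3 [/= h3 C3]] [w4 [/= h4 C4]]; apply: contrapT => /not_orP[nA nB].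
have side D : D w1 -> D w2 -> ~ crossing D C ->
    (forall w, C w -> D w) \/ (forall w, ~ C w -> D w).
  move=> D1 D2 nD; apply: contrapT => /not_orP[/existsNP[p /not_implyP[Cp Dp]]].
  move=> /existsNP[q /not_implyP[Cq Dq]]; apply: nD; split.
  - by exists w1.
  - by exists w2.
  - by exists p.
  - by exists q.
have := side A A1 A2 nA; have := side B B1 B2 nB; have := EM (C v).
by move: (C v) h3 h4 C3 C4 vA vB => Cv h3 h4 C3 C4 vA vB [] ? [sB|sB] [sA|sA];
  move: (sA v) (sB v) (sA w3) (sB w3) (sA w4) (sB w4); tauto.
Qed.

Lemma crossingU A B C : crossing A B -> crossing (A `|` B) C ->
  crossing A C \/ crossing B C.
Proof.
move=> AB; rewrite -crossingCE setCU => /(crossingI _)-/(_ _)[].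
- by apply/crossingCE/crossingCr.
- by rewrite crossingCE; left.
- by rewrite crossingCE; right.
Qed.

Lemma crossingIU A B C : crossing (A `&` B) C -> crossing (A `|` B) C ->
  crossing A C /\ crossing B C.
Proof.
move=> [[w1 [/= [A1 B1] C1]] [w2 [/= [A2 B2] C2]] _ _] [_ _].
move=> [w3 [/= /not_orP[A3 B3] C3]] [w4 [/= /not_orP[A4 B4] C4]].
by split; split; [exists w1|exists w2|exists w3|exists w4|
                  exists w1|exists w2|exists w3|exists w4].
Qed.

End CrossingTheory.

(** * Cuts with minimum boundary and fewest crossings *)

Section Uncrossing.
Variables (W : choiceType) (edges : set (W * W)) (n : nat).
Implicit Types (A B C : set W) (x y : set (set W)).

Definition boundary A := [set e | edges e /\ ~ (A e.1 <-> A e.2)].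
(** Pairs are ordered, so a symmetric edge counts twice. An infinite boundary has cost [0], the
    default of [fset_set]; finiteness of boundaries is therefore always required separately. *)
Definition cost A := card (boundary A).

Lemma boundaryC A : boundary (~` A) = boundary A.
Proof.
apply/seteqP; split => -[u v] [/= e h]; split => //= h'; apply: h => /=.
  by rewrite h'.
by split; [move=> Au|move=> Av]; apply: contrapT; have := EM (A u); have := EM (A v); tauto.
Qed.

(* The ultrafilters [x] and [y] play the role of ends; principal ones, that is,
   points of [W], are allowed too. *)
Definition mincut x y A := [/\ finite_set (boundary A), x A, ~ y A &
  forall B, finite_set (boundary B) -> x B -> ~ y B -> cost A <= cost B].

Lemma mincutC x y A : UltraFilter x -> UltraFilter y -> mincut x y A ->
  mincut y x (~` A).
Proof.
move=> xU yU [fA xA yA minA]; split; rewrite ?boundaryC //.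
- exact/ultraC.
- by rewrite ultraC.
- move=> B fB yB xB; rewrite /cost boundaryC -(boundaryC B); apply: minA.
  + by rewrite boundaryC.
  + exact/ultraC.
  + by rewrite ultraC.
Qed.

(** The cost bound [n] is the same for all pairs of ultrafilters; later it bounds the diameter of
    the boundary and thereby makes [crossers] finite. *)
Definition thin A := exists x y,
  [/\ UltraFilter x, UltraFilter y, mincut x y A & cost A <= n].

Lemma thinC A : thin A -> thin (~` A).
Proof.
move=> [x [y [xU yU m c]]]; exists y, x; split => //; first exact: mincutC.
by rewrite /cost boundaryC.
Qed.

Definition crossers A := [set B | thin B /\ crossing A B].
Hypothesis crossers_finite : forall A, thin A -> finite_set (crossers A).

Lemma crossersC A : crossers (~` A) = crossers A.
Proof. by apply/seteqP; split => B [tB /crossingCl]; rewrite ?setCK. Qed.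

Definition optcut x y A := [/\ mincut x y A, cost A <= n &
  forall B, mincut x y B -> card (crossers A) <= card (crossers B)].

Lemma optcutC x y A : UltraFilter x -> UltraFilter y -> optcut x y A ->
  optcut y x (~` A).
Proof.
move=> xU yU [mA cA oA]; split; first exact: mincutC.
  by rewrite /cost boundaryC.
move=> B /(mincutC yU xU) /oA; by rewrite !crossersC.
Qed.

Lemma optcut_thin x y A : UltraFilter x -> UltraFilter y -> optcut x y A -> thin A.
Proof. by move=> xU yU [mA cA _]; exists x, y. Qed.

Lemma finite_boundaryIU A B : finite_set (boundary A) -> finite_set (boundary B) ->
  finite_set (boundary (A `&` B)) /\ finite_set (boundary (A `|` B)).
Proof.
move=> fA fB; have fU : finite_set (boundary A `|` boundary B) by rewrite finite_setU.
split; apply: sub_finite_set fU => -[u v] [/= e h].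
  have [hA|hA] := EM (A u <-> A v); [right|left]; split => //= hB.
  by apply: h; rewrite /setI /= hA hB.
have [hA|hA] := EM (A u <-> A v); [right|left]; split => //= hB.
by apply: h; rewrite /setU /= hA hB.
Qed.

Lemma cost_submodular A B : finite_set (boundary A) -> finite_set (boundary B) ->
  cost (A `&` B) + cost (A `|` B) <= cost A + cost B.
Proof.
move=> fA fB; apply: card_submodular => //.
  move=> -[u v] [] [/= e h].
    have [hA|hA] := EM (A u <-> A v); [right|left]; split => //= hB.
    by apply: h; rewrite /setI /= hA hB.
  have [hA|hA] := EM (A u <-> A v); [right|left]; split => //= hB.
  by apply: h; rewrite /setU /= hA hB.
move=> -[u v] [[/= e h1] [_ /= h2]].
move: h1 h2; rewrite /setI /setU /= => h1 h2.
by split; split => //=; have := EM (A u); have := EM (A v);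
  have := EM (B u); have := EM (B v); tauto.
Qed.

(** A cut crossing one corner crosses [A] or [B], and a cut crossing both corners crosses both.
    Strictness comes from [B] itself, which crosses [A] but neither corner. *)
Lemma crossers_submodular A B : thin A -> thin B -> crossing A B ->
  card (crossers (A `&` B)) + card (crossers (A `|` B)) <
  card (crossers A) + card (crossers B).
Proof.
move=> tA tB AB; apply: (@card_submodular_lt _ _ _ _ _ B).
- move=> C [] [tC] => [/(crossingI AB)|/(crossingU AB)] [] h; by [left|right].
- by move=> C [[tC h1] [_ h2]]; have [? ?] := crossingIU h1 h2.
- exact: crossers_finite.
- exact: crossers_finite.
- by split.
- by move=> [_ [_ [w [[_ ?]]]]].
- by move=> [_ [_ _ [w [/not_orP[_ ?]]]]].
Qed.

Lemma mincut_sep x y A B : mincut x y A -> finite_set (boundary B) -> x B -> ~ y B ->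
  cost A <= cost B.
Proof. by move=> [_ _ _]; apply. Qed.

Lemma mincut_eq x y A B : mincut x y A -> finite_set (boundary B) -> x B -> ~ y B ->
  cost B <= cost A -> mincut x y B.
Proof.
move=> [_ _ _ mA] fB xB yB BA; split => // C fC xC yC.
exact: leq_trans BA (mA C fC xC yC).
Qed.

(* The corner [A `&` B] is again minimal for [x, y], and [A `|` B] for [x', y'];
   so passing to the corners would decrease the total number of crossings. *)
Lemma opt_corner x y x' y' A B :
  UltraFilter x -> UltraFilter y -> UltraFilter x' -> UltraFilter y' ->
  optcut x y A -> optcut x' y' B -> crossing A B -> x B -> y' A.
Proof.
move=> xU yU xU' yU' oA oB AB xB; apply: contrapT => yA'.
have tA := optcut_thin xU yU oA; have tB := optcut_thin xU' yU' oB.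
have [mA cA minA] := oA; have [mB cB minB] := oB.
have [fA xA yA _] := mA; have [fB xB' yB' _] := mB.
have [fI fU] := finite_boundaryIU fA fB.
have sub := cost_submodular fA fB.
have xI : x (A `&` B) by exact/ultraI.
have yI : ~ y (A `&` B) by move/ultraI => [].
have xU1 : x' (A `|` B) by apply/ultraU; right.
have yU1 : ~ y' (A `|` B) by move/ultraU => [].
have h1 := mincut_sep mA fI xI yI; have h2 := mincut_sep mB fU xU1 yU1.
have h3 : mincut x y (A `&` B) by apply: (mincut_eq mA) => //; lia.
have h4 : mincut x' y' (A `|` B) by apply: (mincut_eq mB) => //; lia.
have := crossers_submodular tA tB AB; have := minA _ h3; have := minB _ h4.
by lia.
Qed.

(** Each cut separates the pair of the other. Hence [B] costs no more than [A], both corners are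
    minimal for [x] and [y], and each has at least as many crossers as [A]; strict submodularity
    leaves more than that for [B]. *)
Lemma opt_same_sep x y x' y' A B :
  UltraFilter x -> UltraFilter y -> UltraFilter x' -> UltraFilter y' ->
  optcut x y A -> optcut x' y' B -> crossing A B ->
  x B -> ~ y B -> y' A -> ~ x' A -> card (crossers A) < card (crossers B).
Proof.
move=> xU yU xU' yU' oA oB AB xB yB yA' xA'.
have tA := optcut_thin xU yU oA; have tB := optcut_thin xU' yU' oB.
have [mA cA minA] := oA; have [mB cB minB] := oB.
have [fA xA yA _] := mA; have [fB xB' yB' _] := mB.
have [fI fU] := finite_boundaryIU fA fB.
have sub := cost_submodular fA fB.
have cBA : cost B <= cost A.
  have [fB' xB'' yB'' mC] := mincutC xU' yU' mB.
  by have := mC A fA yA' xA'; rewrite {1}/cost boundaryC.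
have xI : x (A `&` B) by exact/ultraI.
have yI : ~ y (A `&` B) by move/ultraI => [].
have xU1 : x (A `|` B) by apply/ultraU; right.
have yU1 : ~ y (A `|` B) by move/ultraU => [].
have h1 := mincut_sep mA fI xI yI; have h2 := mincut_sep mA fU xU1 yU1.
have h3 : mincut x y (A `&` B) by apply: (mincut_eq mA) => //; lia.
have h4 : mincut x y (A `|` B) by apply: (mincut_eq mA) => //; lia.
have := crossers_submodular tA tB AB; have := minA _ h3; have := minA _ h4.
by lia.
Qed.

Definition opt A := exists x y, [/\ UltraFilter x, UltraFilter y & optcut x y A].

Lemma optC A : opt A -> opt (~` A).
Proof. by move=> [x [y [xU yU oA]]]; exists y, x; split => //; exact: optcutC. Qed.

Lemma opt_thin A : opt A -> thin A.
Proof. by move=> [x [y [xU yU oA]]]; exact: optcut_thin oA. Qed.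

(** Once [B] is on the side of [x], [opt_corner] for three choices of complements shows that each
    cut separates the pair of the other; then [opt_same_sep] holds in both directions, which is
    absurd. *)
Lemma opt_nested A B : opt A -> opt B -> ~ crossing A B.
Proof.
move=> [x [y [xU yU oA]]] [x' [y' [xU' yU' oB]]] AB.
wlog xB : x' y' B xU' yU' oB AB / x B.
  move=> H; have [xB|xB] := EM (x B); first exact: (H x' y' B).
  apply: (H y' x' (~` B)) => //.
  - exact: optcutC.
  - exact/crossingCr.
  - exact/ultraC.
have yA' : y' A := opt_corner xU yU xU' yU' oA oB AB xB.
have yB : ~ y B.
  move=> yB; have AcB : crossing (~` A) B by exact/crossingCE.
  have := opt_corner yU xU xU' yU' (optcutC xU yU oA) oB AcB yB.
  by rewrite ultraC.
have xA' : ~ x' A.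
  have AcBc : crossing (~` A) (~` B) by apply/crossingCE/crossingCr.
  have := opt_corner yU xU yU' xU' (optcutC xU yU oA) (optcutC xU' yU' oB) AcBc.
  by rewrite !ultraC; exact.
have h1 : card (crossers A) < card (crossers B) by apply: (@opt_same_sep x y x' y').
have h2 : card (crossers (~` B)) < card (crossers A).
  have AcB : crossing (~` B) A by apply/crossing_sym/crossingCr.
  apply: (opt_same_sep yU' xU' xU yU (optcutC xU' yU' oB) oA AcB) => //.
    exact/ultraC.
  by rewrite ultraC => /(_ xB).
by rewrite crossersC in h2; lia.
Qed.

End Uncrossing.

(** * The tree of a nested family of cuts *)

Lemma exists_min {U : Type} (P : U -> Prop) (f : U -> nat) :
  (exists x, P x) -> exists x, P x /\ forall y, P y -> f x <= f y.
Proof.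
move=> [x0 Px0]; have ex : exists n, `[< exists2 x, P x & f x = n >].
  by exists (f x0); apply/asboolP; exists x0.
case: (ex_minnP ex) => m /asboolP[x Px <-] min; exists x; split => // y Py.
by apply: min; apply/asboolP; exists y.
Qed.

Section StructureTree.
Variables (W : Type) (E : set (set W)).
Implicit Types (A B C : set W) (O : set (set W)).
Hypothesis E_nonempty : E !=set0.
Hypothesis E_compl : forall A, E A -> E (~` A).
Hypothesis E_proper : forall A, E A -> A !=set0.
Hypothesis E_nested : forall A B, E A -> E B -> ~ crossing A B.
Hypothesis E_interval : forall A B, E A -> E B ->
  finite_set [set C | E C /\ A `<=` C /\ C `<=` B].

(* A vertex of the structure tree is encoded as the set of all cuts on whose side
   it lies; this one is the endpoint on the side of [A] of the edge {A, ~` A}. *)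
Definition orient A : set (set W) :=
  [set B | E B /\ (A `<=` B \/ ~` B `<=` A /\ ~` B <> A)].

Lemma E_nestedP A B : E A -> E B ->
  [\/ A `<=` B, A `<=` ~` B, ~` A `<=` B | ~` A `<=` ~` B].
Proof.
move=> EA EB; have [h1|h1] := EM (A `<=` B); first by constructor 1.
have [h2|h2] := EM (A `<=` ~` B); first by constructor 2.
have [h3|h3] := EM (~` A `<=` B); first by constructor 3.
have [h4|h4] := EM (~` A `<=` ~` B); first by constructor 4.
have nsub (X Y : set W) : ~ X `<=` Y -> X `&` ~` Y !=set0.
  by move=> /existsNP[w /not_implyP[? ?]]; exists w.
have := E_nested EA EB; case; split; [rewrite -[B]setCK| |rewrite -[B]setCK|]; exact: nsub.
Qed.

Lemma E_not_sub A B : E A -> A `<=` B -> ~ A `<=` ~` B.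
Proof. by move=> /E_proper[w Aw] AB AcB; exact: (AcB w Aw (AB w Aw)). Qed.

Lemma orient_refl A : E A -> orient A A.
Proof. by move=> EA; split => //; left. Qed.

Lemma orientP A B : E A -> E B -> orient A B \/ orient A (~` B).
Proof.
move=> EA EB; have EB' := E_compl EB.
have [AB|AB] := EM (A = B); first by left; split => //; left; rewrite AB.
have [AB'|AB'] := EM (A = ~` B); first by right; split => //; left; rewrite AB'.
case: (E_nestedP EA EB) => h.
- by left; split => //; left.
- by right; split => //; left.
- left; split => //; right; split; first by move: h => /subsetC; rewrite setCK.
  by move=> e; apply: AB'.
- right; split => //; right; rewrite setCK; split; last by move=> e; apply: AB.
  by move: h => /subsetC; rewrite !setCK.
Qed.

Lemma orientN A B : E A -> orient A B -> ~ orient A (~` B).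
Proof.
move=> EA [EB h] [EB' h']; move: h'; rewrite setCK.
case: h => [AB|[BA nBA]] [AB'|[BA' nBA']].
- exact: E_not_sub AB AB'.
- by apply: nBA'; apply/seteqP.
- by apply: nBA; apply/seteqP.
- have [w] := E_proper (E_compl EA); apply.
  by have [Bw|Bw] := EM (B w); [exact: BA'|exact: BA].
Qed.

Lemma orient_up A B C : E A -> orient A B -> E C -> B `<=` C -> orient A C.
Proof.
move=> EA [EB h] EC BC; split => //; case: h => [AB|[BA nBA]].
  by left; apply: subset_trans BC.
right; split; first by apply: subset_trans BA; exact: subsetC.
move=> CA; apply: nBA; apply/seteqP; split => //.
by rewrite -CA; exact: subsetC.
Qed.

Lemma orient_min A C : E A -> orient A C -> C `<=` A -> C = A.
Proof.
move=> EA [EC [AC|[CA nCA]]] sCA; first exact/seteqP.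
have [w] := E_proper (E_compl EA); case.
by have [Cw|Cw] := EM (C w); [exact: sCA|exact: CA].
Qed.

Lemma orient_sub_eq A B : E A -> E B -> orient A `<=` orient B -> orient A = orient B.
Proof.
move=> EA EB AB; apply/seteqP; split => // C BC.
have [//|/AB BC'] := orientP EA (proj1 BC).
by case: (orientN EB BC BC').
Qed.

(** The edges at a vertex are the minimal elements of its set: any of them, taken as base, gives the
    same vertex. *)
Lemma orient_eq A B : E A -> orient A B ->
  (forall C, orient A C -> C `<=` B -> C = B) -> orient B = orient A.
Proof.
move=> EA AB minB; have EB := proj1 AB; apply: orient_sub_eq => // C [EC [BC|[CB nCB]]].
  exact: orient_up AB EC BC.
have [//|AC'] := orientP EA EC.
by case: nCB; apply: minB.
Qed.

(** Crossing the edge of [A] reverses [A] and no other cut. *)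
Lemma orient_flip A B : E A -> orient A B -> B <> A -> orient (~` A) B.
Proof.
move=> EA [EB [AB|[BA nBA]]] nAB; split => //.
  by right; split; [exact: subsetC|move=> /(congr1 setC); rewrite !setCK].
by left; move: BA => /subsetC; rewrite setCK.
Qed.

Lemma orient_flipP A B : E A -> orient (~` A) B -> B = ~` A \/ orient A B.
Proof.
move=> EA AB; have [e|ne] := EM (B = ~` A); [by left|right].
by have := orient_flip (E_compl EA) AB ne; rewrite setCK.
Qed.

(** The complements of the cuts incident to a vertex are the pieces beyond its edges, hence pairwise
    disjoint. *)
Lemma orient_disjoint A B : E A -> E B -> orient A = orient B -> A <> B -> ~` A `<=` B.
Proof.
move=> EA EB AB nAB; have : orient A B by rewrite AB; exact: orient_refl.
move=> [_ [h|[h _]]]; last by move: h => /subsetC; rewrite setCK.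
case: nAB; apply: orient_min h => //.
by rewrite -AB; exact: orient_refl.
Qed.

Lemma finite_min (S : set (set W)) : finite_set S -> S !=set0 ->
  exists2 C, S C & forall D, S D -> D `<=` C -> D = C.
Proof.
move=> fS [C0 SC0].
have [|C [[SC CC] minC]] := @exists_min _ (fun C => S C /\ C `<=` C0)
   (fun C => #|`fset_set [set D | S D /\ D `<=` C]|).
  by exists C0; split => //; exact: subset_refl.
exists C => // D SD DC; apply: contrapT => nDC.
have := minC D (conj SD (subset_trans DC CC)); rewrite leqNgt => /negP; apply.
have fC : finite_set [set D | S D /\ D `<=` C] by apply: sub_finite_set fS => X [].
apply: (@card_proper _ _ _ C) => //.
- by move=> X [SX XD]; split => //; exact: subset_trans DC.
- by split => //; exact: subset_refl.
- by move=> [_ CD]; apply: nDC; exact/seteqP.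
Qed.

(** Every cut of a vertex is screened by an incident one. The candidates below [D], or their
    complements, lie in finite intervals of the family, so there is a minimal one, and it is
    incident by [orient_eq]. *)
Lemma orient_below A D : E A -> orient A D ->
  exists C, [/\ E C, orient C = orient A & C `<=` D].
Proof.
move=> EA AD; have ED := proj1 AD.
have [||C [AC CD] minC] := @finite_min [set C | orient A C /\ C `<=` D].
- case: (proj2 AD) => [sAD|[sDA _]].
    apply: (@sub_finite_set _ _ ([set A] `|` [set C | E C /\ A `<=` C /\ C `<=` D] `|`
      setC @` [set C | E C /\ ~` D `<=` C /\ C `<=` A])); last first.
      by rewrite !finite_setU; split; [split => //; exact: E_interval|
        apply: finite_image; apply: E_interval => //; exact: E_compl].
    move=> C [[EC [AC|[CA _]]] CD]; first by left; right.
    right; exists (~` C); rewrite ?setCK //; split; first exact: E_compl.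
    by split => //; exact: subsetC.
  apply: (@sub_finite_set _ _ ([set C | E C /\ A `<=` C /\ C `<=` D] `|`
      setC @` [set C | E C /\ ~` D `<=` C /\ C `<=` A])); last first.
    by rewrite finite_setU; split; [exact: E_interval|
      apply: finite_image; apply: E_interval => //; exact: E_compl].
  move=> C [[EC [AC|[CA _]]] CD]; first by left.
  right; exists (~` C); rewrite ?setCK //; split; first exact: E_compl.
  by split => //; exact: subsetC.
- by exists D; split => //; exact: subset_refl.
exists C; split => //; first exact: (proj1 AC).
apply: orient_eq => // C' AC' C'C; apply: minC => //; split => //.
exact: subset_trans CD.
Qed.

Record node := Node { node_set : set (set W);
  nodeP : exists2 A, E A & node_set = orient A }.

Lemma node_eq (s t : node) : node_set s = node_set t -> s = t.
Proof.
by case: s t => [O P] [O' P'] /= e; subst O'; rewrite (Prop_irrelevance P P').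
Qed.

HB.instance Definition _ := gen_eqMixin node.
HB.instance Definition _ := gen_choiceMixin node.

Definition node_of A (EA : E A) : node := Node (ex_intro2 _ _ A EA erefl).

Definition node_adj (s t : node) : bool :=
  `[< exists A, [/\ E A, node_set s = orient A & node_set t = orient (~` A)] >].

Lemma node_adj_sym : symmetric node_adj.
Proof.
suff H s t : node_adj s t -> node_adj t s by move=> s t; apply/idP/idP; exact: H.
move=> /asboolP[A [EA sA tA]]; apply/asboolP; exists (~` A); rewrite setCK.
by split => //; exact: E_compl.
Qed.

Lemma orientC_neq A : E A -> ~ orient (~` A) A.
Proof.
move=> EA h; have := orientN (E_compl EA) h; apply; exact/orient_refl/E_compl.
Qed.

Lemma node_adj_irr : irreflexive node_adj.
Proof.
move=> s; apply/negbTE/negP => /asboolP[A [EA sA]]; rewrite sA => e.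
by apply: (orientC_neq EA); rewrite -e; exact: orient_refl.
Qed.

Lemma node_edge s t A : E A -> node_adj s t -> node_set s A -> ~ node_set t A ->
  node_set s = orient A /\ node_set t = orient (~` A).
Proof.
move=> EA /asboolP[B [EB -> ->]] BA nBA.
have [->//|ne] := EM (A = B).
by case: nBA; exact: orient_flip.
Qed.

Lemma orient_diff_finite A B : E A -> E B ->
  finite_set [set C | orient A C /\ ~ orient B C].
Proof.
move=> EA EB; have EA' := E_compl EA; have EB' := E_compl EB.
apply: (@sub_finite_set _ _ (
  ([set C | E C /\ A `<=` C /\ C `<=` B] `|` [set C | E C /\ A `<=` C /\ C `<=` ~` B]) `|`
  ([set C | E C /\ ~` A `<=` C /\ C `<=` B] `|` [set C | E C /\ ~` A `<=` C /\ C `<=` ~` B]))).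
  move=> C [[EC hA] nBC]; have [//|[_ hB]] := orientP EB EC.
  have hB' : C `<=` B \/ C `<=` ~` B.
    case: hB => [h|[h _]]; last by left; rewrite setCK in h.
    by right; move: h => /subsetC; rewrite setCK.
  have hA' : A `<=` C \/ ~` A `<=` C.
    case: hA => [h|[h _]]; first by left.
    by right; move: h => /subsetC; rewrite setCK.
  by case: hA' hB' => h [h'|h']; [left; left|left; right|right; left|right; right].
by rewrite !finite_setU; do 2! split; exact: E_interval.
Qed.

(** Induction on the number of cuts of [s] that are not cuts of [t]. A minimal one is incident to
    [s], because the set of [t] is closed under enlargement; crossing it lowers the number. *)
Lemma node_path_exists (s t : node) : exists2 p, path node_adj s p & last s p = t.
Proof.
move: s t => s t; have [B EB tB] := nodeP t.
move En : (#|`fset_set [set C | node_set s C /\ ~ node_set t C]|) => n.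
elim: n {-2}n (leqnn n) s En => [|n IH] m mn s En.
- have [A EA sA] := nodeP s; exists [::] => //=; apply: node_eq.
  rewrite sA tB; apply: orient_sub_eq => // C AC; apply: contrapT => BC.
  have fS := orient_diff_finite EA EB.
  have := @card_proper _ set0 _ C (@sub0set _ _) fS (conj AC BC) id.
  by rewrite -sA -tB En; lia.
- have [A EA sA] := nodeP s; have fS := orient_diff_finite EA EB.
  have [S0|S0] := EM ([set C | orient A C /\ ~ orient B C] !=set0); last first.
    exists [::] => //=; apply: node_eq; rewrite sA tB; apply: orient_sub_eq => // C AC.
    by apply: contrapT => BC; apply: S0; exists C.
  have [C [AC BC] minC] := finite_min fS S0; have EC := proj1 AC.
  have eC : orient C = orient A.
    apply: orient_eq => // D AD DC; apply: minC => //; split => // BD.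
    by apply: BC; exact: orient_up DC.
  pose s' := node_of (E_compl EC).
  have ss' : node_adj s s' by apply/asboolP; exists C; rewrite sA eC.
  have [|p s'p pt] := IH _ _ s' erefl; last by exists (s' :: p) => //=; rewrite ss'.
  rewrite -ltnS; apply: leq_trans mn; rewrite -En /= sA tB.
  apply: (@card_proper _ _ _ C) => //.
    move=> D [CD BD]; split => //; case: (orient_flipP EC CD) => [e|]; last by rewrite eC.
    by case: BD; rewrite e; have [] := orientP EB EC.
  by move=> [h _]; exact: orientC_neq h.
Qed.

(** Leaving [s] through [A] gives up [A], which only the same edge recovers; so the cycle would have
    to return through [t]. *)
Lemma node_acyclic (c : seq node) : ucycle node_adj c -> size c <= 2.
Proof.
case: c => [|s [|t [|u c]]] // /andP[].
move=> /= /and3P[st tu]; rewrite rcons_path => /andP[uc lc] /and4P[h1 h2 h3 _].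
move/asboolP: st => [A [EA sA tA]].
have step x y : ~ node_set x A -> node_adj x y -> y <> s -> ~ node_set y A.
  move=> xA xy ys yA; apply: ys; apply: node_eq; rewrite sA.
  by apply: (proj1 (node_edge EA _ yA xA)); rewrite node_adj_sym.
have tA' : ~ node_set t A by rewrite tA; exact: orientC_neq.
have uA : ~ node_set u A.
  by apply: (step t) => // e; move: h1; rewrite !inE e eqxx !orbT.
have lA : ~ node_set (last u c) A.
  have : s \notin c by move: h1; rewrite !inE !negb_or => /and3P[].
  elim: c u uA uc {tu lc h1 h2 h3} => //= x c IH u uA /andP[ux xc].
  rewrite inE negb_or => /andP[sx sc]; apply: (IH x) => //.
  by apply: (step u) => // e; move: sx; rewrite e eqxx.
have sA' : node_set s A by rewrite sA; exact: orient_refl.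
have := node_edge EA; rewrite node_adj_sym in lc.
move=> /(_ _ _ lc sA' lA)[_ e].
have : last u c = t by apply: node_eq; rewrite e tA.
by move=> e'; move: h2; rewrite -e' mem_last.
Qed.

Lemma node_inhabited : inhabited node.
Proof. by have [A EA] := E_nonempty; exists; exact: node_of EA. Qed.

Definition structure_tree := SimplicialTree node_adj_sym node_adj_irr
  node_inhabited node_path_exists node_acyclic.

Lemma structure_half (s t v : vertex structure_tree) A : E A ->
  node_set s = orient A -> node_set t = orient (~` A) -> ~ node_set v A ->
  half s t v.
Proof.
move=> EA sA tA; rewrite /half /=; move En : (dist v s) => n.
elim: n v En => [|n IH] v En vA.
  by case: vA; rewrite (dist_eq0 En) sA; exact: orient_refl.
have [|w vw ws] := @dist_mid _ v s 1; first by lia.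
have [wA|wA] := EM (node_set w A).
  have wv : node_adj w v by apply: (@adj_dist structure_tree); rewrite dist_sym.
  have [_ e] := node_edge EA wv wA vA.
  have -> : v = t by apply: node_eq; rewrite e tA.
  by rewrite dist0.
have := IH w; rewrite ws En subn1 => /(_ erefl wA).
by have := dist_tri w v t; lia.
Qed.

End StructureTree.

(** * Minimal cuts of a locally finite G-set quasi-isometric to a tree *)

Lemma card_image_inj {U X : choiceType} (f : U -> X) (S : set U) :
  injective f -> finite_set S -> card (f @` S) = card S.
Proof. by move=> fI fS; rewrite fset_set_image // card_imfset. Qed.

Lemma card_image_le {U X : choiceType} (f : U -> X) (S : set U) :
  finite_set S -> card (f @` S) <= card S.
Proof. by move=> fS; rewrite fset_set_image // leq_imfset_card. Qed.

Lemma ultra_preimage {W : Type} (x : set (set W)) (f : W -> W) :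
  UltraFilter x -> UltraFilter [set B | x (f @^-1` B)].
Proof.
move=> xU; have PF : ProperFilter [set B | x (f @^-1` B)].
  split; first by rewrite /= preimage_set0; exact: filter_not_empty.
  split; rewrite /=; first by rewrite preimage_setT; exact: filterT.
    by move=> P Q; exact: filterI.
  by move=> P Q PQ; apply: filterS => u; exact: PQ.
split => // F PFF xF; apply/seteqP; split => // A FA; rewrite /=.
have [//|h] := in_ultra_setVsetC (f @^-1` A) xU.
by have /filter_ex[? []] : F (A `&` ~` A) by apply: filterI => //; exact: xF.
Qed.

Section CutsOfGSet.
Variables (T : simplicial_tree) (G : groupType) (W : choiceType).
Variables (act : G -> W -> W) (pi : W -> vertex T) (L D : nat).
Hypothesis T_valence : bounded_valence T.
Hypothesis act1 : forall u, act 1%g u = u.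
Hypothesis actM : forall g h u, act (g * h)%g u = act g (act h u).
Hypothesis fibre_finite : forall t, finite_set [set u | pi u = t].
Hypothesis act_lipschitz : forall g u v,
  dist (pi (act g u)) (pi (act g v)) <= L * dist (pi u) (pi v) + L.
Hypothesis coarsely_onto : forall t, exists u, dist t (pi u) <= D.
Hypothesis transitive_act : forall u v, exists g, act g u = v.

Lemma actK g u : act g^-1%g (act g u) = u.
Proof. by rewrite -actM mulVg act1. Qed.

Lemma actKV g u : act g (act g^-1%g u) = u.
Proof. by rewrite -actM mulgV act1. Qed.

Lemma act_inj g : injective (act g).
Proof. by move=> u v /(congr1 (act g^-1%g)); rewrite !actK. Qed.

Lemma balls_finite t r : finite_set [set u | dist (pi u) t <= r].
Proof.
apply: (@sub_finite_set _ _ (\bigcup_(s in [set s | dist t s <= r]) [set u | pi u = s])).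
  by move=> u /= ut; exists (pi u) => //=; rewrite dist_sym.
by apply: bigcup_finite => //; exact: ball_finite.
Qed.

(* Quantifying over [g] makes the edges invariant under [G], although [pi] is only
   coarsely equivariant. *)
Definition cayley_edges : set (W * W) :=
  [set e | exists g, dist (pi (act g e.1)) (pi (act g e.2)) <= D.*2.+1].

Let ed := cayley_edges.

(** The terms with [L] come from moving an edge back by the inverse group element; the last summand
    gives [D <= edge_length] even if [L = 0]. *)
Definition edge_length := L * D.*2.+1 + L + D.*2.+1.
Let r := edge_length.

Lemma edge_lengthP u v : ed (u, v) -> dist (pi u) (pi v) <= r.
Proof.
move=> [g /= h]; have := act_lipschitz g^-1%g (act g u) (act g v).
by rewrite !actK /r /edge_length; nia.
Qed.

Lemma close_edge u v : dist (pi u) (pi v) <= D.*2.+1 -> ed (u, v).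
Proof. by move=> h; exists 1%g; rewrite /= !act1. Qed.

Lemma edge_sym u v : ed (u, v) -> ed (v, u).
Proof. by move=> [g h]; exists g; rewrite dist_sym. Qed.

Lemma edge_act g u v : ed (act g u, act g v) <-> ed (u, v).
Proof.
split => -[h /= hh]; first by exists (h * g)%g; rewrite /= !actM.
by exists (h * g^-1)%g; rewrite /= !actM !actK.
Qed.

Definition spot (A : set W) u := exists2 v, ed (u, v) & ~ (A u <-> A v).

Lemma spotC A u : spot (~` A) u <-> spot A u.
Proof.
by split => -[v uv h]; exists v => //; move: h; rewrite /setC /=;
  have := EM (A u); have := EM (A v); tauto.
Qed.

Lemma spot_located A c R : (forall u, spot A u -> dist (pi u) c <= R) ->
  located pi D c R A.
Proof.
move=> h v w Av Aw vw; have e := close_edge vw; split; apply: h.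
  by exists w => // -[/(_ Av)].
by exists v; [exact: edge_sym|move=> [_ /(_ Av)]].
Qed.

Lemma spot_neighbour A u : spot A u -> exists v1 v2, [/\ A v1, ~ A v2,
  dist (pi u) (pi v1) <= r & dist (pi u) (pi v2) <= r].
Proof.
move=> [v uv h]; have e := edge_lengthP uv; have [Au|Au] := EM (A u).
  by exists u, v; split; rewrite ?dist0 //; tauto.
by exists v, u; split; rewrite ?dist0 //; apply: contrapT; tauto.
Qed.

(** * Half-trees as cuts *)

Definition pull a b := [set u | half a b (pi u)].

Lemma edge_pull a b u v : adj a b -> ed (u, v) -> pull a b u -> ~ pull a b v ->
  dist (pi u) a <= r /\ dist (pi v) a <= r.
Proof.
move=> ab /edge_lengthP uv Hu Hv; have := half_cross ab Hu Hv.
have := dist_tri b (pi u) a; have := dist_adj ab.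
by rewrite (dist_sym a b) (dist_sym (pi v) a); lia.
Qed.

Lemma spot_pull a b u : adj a b -> spot (pull a b) u -> dist (pi u) a <= r.
Proof.
move=> ab [v uv h]; have [Hu|Hu] := EM (pull a b u).
  have Hv : ~ pull a b v by move=> Hv; apply: h; split.
  by have [] := edge_pull ab uv Hu Hv.
have Hv : pull a b v by apply: contrapT => Hv; apply: h; split.
by have [] := edge_pull ab (edge_sym uv) Hv Hu.
Qed.

(** The boundary lies within [r] of [a]. By transitivity it can be moved close to [u0], into the
    pairs of points of one finite set [B]. *)
Lemma pull_cost : exists n, forall a b, adj a b ->
  finite_set (boundary ed (pull a b)) /\ cost ed (pull a b) <= n.
Proof.
have [t0] := tree_nonempty T; have [u0 _] := coarsely_onto t0.
pose B := [set u | dist (pi u) (pi u0) <= L * (r + D) + L].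
have fB : finite_set (B `*` B) by apply: finite_setX; exact: balls_finite.
exists (card (B `*` B)) => a b ab.
have [u au] := coarsely_onto a; have [g gu] := transitive_act u0 u.
pose f (e : W * W) := (act g e.1, act g e.2).
have sub : boundary ed (pull a b) `<=` f @` (B `*` B).
  have near w : spot (pull a b) w -> B (act g^-1%g w).
    move=> /(spot_pull ab) wa; rewrite /B /= -(actK g u0) gu.
    apply: leq_trans (act_lipschitz _ _ _) _.
    by rewrite leq_add2r leq_mul2l (leq_trans (dist_tri a _ _)) ?orbT // leq_add.
  move=> [v w] [/= vw h]; exists (act g^-1%g v, act g^-1%g w).
    split; apply: near; first by exists w.
    by exists v; [exact: edge_sym|tauto].
  by rewrite /f /= !actKV.
split; first by apply: sub_finite_set sub _; exact: finite_image.
apply: leq_trans (card_image_le f fB); apply: card_sub => //.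
exact: finite_image.
Qed.

(** * Thin cuts have bounded boundary *)

Variable n : nat.
Hypothesis pull_le : forall a b, adj a b ->
  finite_set (boundary ed (pull a b)) /\ cost ed (pull a b) <= n.

Lemma split_spot (A : set W) u u' : A u -> ~ A u' ->
  exists s w, [/\ between (pi u) s (pi u'), spot A w & dist s (pi w) <= D].
Proof.
move=> Au Au'.
have [||s [v [w [bs Av Aw sv vw]]]] := between_split coarsely_onto
  (t := pi u) (t' := pi u') _ _ Au Au'; rewrite ?dist0 //.
exists s, v; split => //; exists w; first exact: close_edge.
by move=> [/(_ Av)].
Qed.

Lemma thin_ex A : thin ed n A -> A !=set0 /\ ~` A !=set0.
Proof.
move=> [x [y [xU yU [_ xA yA _] _]]]; split; first exact: (@filter_ex _ x).
by apply: (@filter_ex _ y); exact/ultraC.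
Qed.

Lemma thin_spot A : thin ed n A -> exists u, spot A u.
Proof.
by move=> /thin_ex[[u Au] [v Av]]; have [_ [w [_ ? _]]] := split_spot Au Av; exists w.
Qed.

(** A geodesic between two points within [r] of [s] stays within [3 * r] of [s], and [split_spot]
    finds spots within [D] of it. So if all spots are farther than this from [s], the points near
    [s] lie on one side. *)
Let gap := 3 * r + D.

(** Pigeonhole: points spaced [gap.*2.+1] apart cannot be within [gap] of the same spot, so [n + 1]
    of them would require [n + 1] boundary edges. *)
Lemma gap_exists A (u v : W) : finite_set (boundary ed A) -> cost ed A <= n ->
  gap.*2.+1 * n <= dist (pi u) (pi v) ->
  exists s, between (pi u) s (pi v) /\ forall w, spot A w -> gap < dist (pi w) s.
Proof.
move=> fA cA uv; apply: contrapT => noS.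
have H (i : 'I_n.+1) : exists e : W * W, boundary ed A e /\
    exists s, dist (pi u) s = gap.*2.+1 * i /\ dist (pi e.1) s <= gap.
  have le_i : gap.*2.+1 * i <= dist (pi u) (pi v).
    by apply: leq_trans uv; rewrite leq_mul2l -ltnS ltn_ord orbT.
  have [s us sv] := dist_mid le_i.
  apply: contrapT => no; apply: noS; exists s; split.
    by rewrite /between us sv subnKC.
  move=> w [w' ww' h]; rewrite ltnNge; apply/negP => ws; apply: no.
  by exists (w, w'); split => //; exists s.
have [f fP] := choice H.
have f_inj : injective f.
  move=> i j e; have [_ [s [us fs]]] := fP i; have [_ [s' [us' fs']]] := fP j.
  rewrite e in fs.
  have h1 := dist_tri s (pi u) s'; have h2 := dist_tri s' (pi u) s.
  have h3 := dist_tri (pi (f j).1) s s'.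
  rewrite (dist_sym s') (dist_sym s (pi (f j).1)) in h2 h3.
  apply: val_inj => /=; apply/eqP; rewrite eqn_leq; apply/andP; split; nia.
have : #|` [fset f i | i : 'I_n.+1]%fset| <= cost ed A.
  apply: fsubset_leq_card; apply/fsubsetP => e /imfsetP[i _ ->].
  by rewrite in_fset_set // inE; have [] := fP i.
by rewrite card_imfset //= -cardE card_ord; lia.
Qed.

(* If the boundary of a minimum cut [A] is spread out, then some edge [(s, b)] of
   [T] separating it is far from it, so that, say, [A] contains everything near
   [s]; then one of the two parts of [~` A] on either side of the edge still
   separates the two ultrafilters, with a smaller boundary. *)
Lemma thin_spots : exists R, forall A, thin ed n A -> forall u v,
  spot A u -> spot A v -> dist (pi u) (pi v) <= R.
Proof.
exists (gap.*2.+1 * n) => A tA u v su sv; rewrite leqNgt; apply/negP => far.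
have [x [y [xU yU mA cA]]] := tA; have [fA _ _ _] := mA.
have [s [us noS]] := gap_exists fA cA (ltnW far).
wlog [u3 su3 Au3] : x y A tA su sv xU yU mA cA fA noS / exists2 u3, dist (pi u3) s <= r & A u3.
  move=> H; have [u3 su3] := coarsely_onto s.
  have u3s : dist (pi u3) s <= r by rewrite dist_sym /r /edge_length; lia.
  have [Au3|Au3] := EM (A u3); first by apply: (H x y A) => //; exists u3.
  apply: (H y x (~` A)) => //.
  - exact: thinC.
  - exact/spotC.
  - exact/spotC.
  - exact: mincutC.
  - by rewrite /cost boundaryC.
  - by rewrite boundaryC.
  - by move=> w /spotC; exact: noS.
  - by exists u3.
have near w : dist (pi w) s <= r -> A w.
  move=> ws; apply: contrapT => Aw.
  have [s' [w' [bs' sw' s'w']]] := split_spot Au3 Aw.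
  have h1 := noS _ sw'; have h2 := dist_tri s' (pi w') s.
  have h3 := dist_tri (pi u3) s' s; have h4 := dist_tri s (pi u3) (pi w).
  move: bs' h1; rewrite /between /gap (dist_sym s (pi w)) in h4 *.
  by have := dist_sym s' (pi w'); have := dist_sym s' (pi u3); lia.
have [|b sb bv] := @dist_mid _ s (pi v) 1.
  by have := noS _ sv; rewrite dist_sym; lia.
have sb' := adj_dist sb; pose H := pull s b.
have vH : H v.
  rewrite /H /pull /half /= (dist_sym (pi v) b) (dist_sym (pi v) s) bv.
  by have := noS _ sv; rewrite dist_sym; lia.
have uH : ~ H u.
  rewrite /H /pull /half /=; have := dist_tri b (pi u) (pi v); rewrite bv.
  by have := noS _ sv; move: us; rewrite /between (dist_sym (pi v) s); lia.
have edgeH w w' : ed (w, w') -> ~ A w -> ~ A w' -> (H w <-> H w').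
  move=> ww' Aw Aw'; split => Hw; apply: contrapT => Hw'.
    by have [/near] := edge_pull sb' ww' Hw Hw'.
  by have [/near] := edge_pull sb' (edge_sym ww') Hw Hw'.
have farH w w' : spot A w -> ed (w, w') -> (H w <-> H w').
  move=> sw ww'; have := noS _ sw; split => Hw; apply: contrapT => Hw'.
    by have [] := edge_pull sb' ww' Hw Hw'; rewrite /gap in H0; lia.
  by have [] := edge_pull sb' (edge_sym ww') Hw Hw'; rewrite /gap in H0; lia.
have [_ xA yA minA] := mA.
(* [K] is the side of the edge containing [y], and the cheaper cut is [A] together with the
   complement of [K]. Strictness: the boundary edges at the spot [w], which is outside [K],
   disappear. *)
have contra (K : set W) w : (forall w w', ed (w, w') -> ~ A w -> ~ A w' -> (K w <-> K w')) ->
   spot A w -> ~ K w -> (forall w', ed (w, w') -> ~ K w') -> y K -> False.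
  move=> edgeK sw Kw Kw' yK.
  have sub : boundary ed (A `|` ~` K) `<=` boundary ed A.
    move=> [p q] [/= pq h]; split => //= hA; apply: h; rewrite /setU /=.
    by have := edgeK p q pq; have := EM (A p); tauto.
  have : cost ed (A `|` ~` K) < cost ed A.
    have [w' ww' hA] := sw.
    apply: (@card_proper _ _ _ (w, w')) => //.
    by move=> [_ /=]; apply; rewrite /setU /=; have := Kw' w' ww'; tauto.
  rewrite ltnNge => /negP; apply; apply: minA.
  - exact: sub_finite_set fA.
  - by apply/ultraU; left.
  - by move/ultraU => [//|/ultraC/(_ yK)].
have [yH|yH] := EM (y H).
  by apply: (contra H u) => // w' uw'; have := farH u w' su uw'; tauto.
apply: (contra (~` H) v) => //.
- by move=> w w' ww' Aw Aw' /=; have := edgeH w w' ww' Aw Aw'; tauto.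
- by move=> w' vw' /=; have := farH v w' sv vw'; tauto.
- exact/ultraC.
Qed.

Variable R : nat.
Hypothesis spots_le : forall A, thin ed n A -> forall u v,
  spot A u -> spot A v -> dist (pi u) (pi v) <= R.

Lemma thin_located A u : thin ed n A -> spot A u -> located pi D (pi u) R A.
Proof. by move=> tA su; apply: spot_located => v sv; exact: (spots_le tA). Qed.

Lemma thin_near A a b c : thin ed n A -> spot A c -> A a -> ~ A b ->
  dist (pi a) (pi c) + dist (pi c) (pi b) <= dist (pi a) (pi b) + (R + D).*2.
Proof.
by move=> tA sc; exact: (located_near coarsely_onto (thin_located tA sc)).
Qed.

Lemma thin_finite t k :
  finite_set [set A | thin ed n A /\ exists2 u, spot A u & dist (pi u) t <= k].
Proof.
apply: (@sub_finite_set _ _ [set A | located pi D t (R + k) A]); last first.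
  by apply: located_finite => //; exact: balls_finite.
move=> A [tA [u su ut]]; apply: spot_located => v sv.
apply: leq_trans (dist_tri (pi u) _ _) _; rewrite leq_add //.
exact: (spots_le tA).
Qed.

Lemma crossers_finite A : thin ed n A -> finite_set (crossers ed n A).
Proof.
move=> tA; have [a sa] := thin_spot tA.
apply: (sub_finite_set _ (thin_finite (pi a) (R + D.*2).*2)) => B [tB AB].
have [b sb] := thin_spot tB; split => //; exists b => //; rewrite dist_sym.
exact: (crossing_near coarsely_onto (thin_located tA sa) (thin_located tB sb)).
Qed.

Definition family := opt ed n.
Let E := family.

Lemma family_thin A : E A -> thin ed n A.
Proof. exact: opt_thin. Qed.

Lemma family_compl A : E A -> E (~` A).
Proof. exact: optC. Qed.

Lemma family_nested A B : E A -> E B -> ~ crossing A B.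
Proof. exact: opt_nested crossers_finite _ _. Qed.

Lemma family_proper A : E A -> A !=set0.
Proof. by move=> /family_thin/thin_ex[]. Qed.

Lemma family_spot A : E A -> exists u, spot A u.
Proof. by move=> /family_thin/thin_spot. Qed.

(** A cut between [A] and [B] separates a fixed point of [A] from a fixed point outside [B], so its
    spots are near the geodesic joining them. *)
Lemma family_interval A B : E A -> E B ->
  finite_set [set C | E C /\ A `<=` C /\ C `<=` B].
Proof.
move=> EA EB; have [a Aa] := family_proper EA.
have [b Bb] := family_proper (family_compl EB).
apply: (sub_finite_set _ (thin_finite (pi a) (dist (pi a) (pi b) + (R + D).*2))).
move=> C [EC [AC CB]]; have tC := family_thin EC; have [c sc] := thin_spot tC.
split => //; exists c => //; have := thin_near tC sc (AC a Aa) (fun h => Bb (CB b h)).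
by rewrite (dist_sym (pi c) (pi a)); lia.
Qed.

(** The half-tree competes in the first minimization, so the minimum cost is at most [n] whatever
    the ultrafilters; a second minimization counts crossings. *)
Lemma family_separates x y a b : UltraFilter x -> UltraFilter y -> adj a b ->
  x (pull a b) -> ~ y (pull a b) -> exists A, [/\ E A, x A & ~ y A].
Proof.
move=> xU yU ab xH yH; have [fH cH] := pull_le ab.
have [|A [[fA xA yA] minA]] := @exists_min _
    (fun A => [/\ finite_set (boundary ed A), x A & ~ y A]) (cost ed).
  by exists (pull a b).
have mA : mincut ed x y A by split => // B fB xB yB; exact: minA.
have [|B [mB minB]] := @exists_min _ (fun B => mincut ed x y B)
    (fun B => card (crossers ed n B)); first by exists A.
have [_ xB yB _] := mB; exists B; split => //; exists x, y; split => //.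
split => //; apply: leq_trans cH; exact: (mincut_sep mB).
Qed.

Lemma arm_infinite v w : arm v w -> infinite_set (pull v w).
Proof.
move=> [vw far] fin; have [N hN] := finite_bounded (fun u => dist v (pi u)) fin.
have [h hh Nh] := far (N + D).+1; have [u hu] := coarsely_onto h.
have [Hu|Hu] := EM (pull v w u).
  by have := hN u Hu; have := dist_tri (pi u) v h; rewrite (dist_sym (pi u)); lia.
have := half_cross vw hh Hu; have := dist_tri w v h; have := dist_adj vw.
by rewrite (dist_sym h w); lia.
Qed.

Lemma branching_family_nonempty : (exists v : vertex T, branching v) -> E !=set0.
Proof.
move=> [v [w1 [w2 [_ [[w12 _ _] [a1 a2 _]]]]]].
have [x [xU xw1 _]] := ultra_infinite (arm_infinite a1).
have [y [yU yw2 _]] := ultra_infinite (arm_infinite a2).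
have [|A [EA _ _]] := family_separates xU yU (proj1 a1) xw1; last by exists A.
move=> yw1; have yI : y (pull v w1 `&` pull v w2) by exact: filterI.
have [u [/= u1 u2]] := @filter_ex _ y _ _ yI.
exact: (half_apart (proj1 a1) (proj1 a2) w12 u1 u2).
Qed.

Lemma infinite_separation (S : set W) a b : adj a b ->
  infinite_set (S `&` pull a b) -> infinite_set (S `&` ~` pull a b) ->
  exists A, [/\ E A, infinite_set (S `&` A) & infinite_set (S `&` ~` A)].
Proof.
move=> ab /ultra_infinite[x [xU xS xF]] /ultra_infinite[y [yU yS yF]].
move: xS yS; rewrite !ultraI ultraC => -[xS xH] [yS yH].
have [A [EA xA yA]] := family_separates xU yU ab xH yH; exists A; split => //.
  by move=> /xF; rewrite ultraI; apply.
by move=> /yF; rewrite ultraI ultraC; apply.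
Qed.

(* This is the translate of [A] by [g^-1]. *)
Definition pre g (A : set W) := [set u | A (act g u)].

Lemma preK g A : pre g (pre g^-1%g A) = A.
Proof. by apply/seteqP; split => u; rewrite /pre /= actK. Qed.

Lemma preKV g A : pre g^-1%g (pre g A) = A.
Proof. by apply/seteqP; split => u; rewrite /pre /= actKV. Qed.

Lemma pre1 A : pre 1%g A = A.
Proof. by apply/seteqP; split => u; rewrite /pre /= act1. Qed.

Lemma preM g h A : pre (g * h)%g A = pre h (pre g A).
Proof. by apply/seteqP; split => u; rewrite /pre /= actM. Qed.

Lemma pre_sub g A B : A `<=` B -> pre g A `<=` pre g B.
Proof. by move=> AB u; exact: AB. Qed.

Lemma spot_pre g A u : spot (pre g A) u <-> spot A (act g u).
Proof.
split => -[v uv h]; first by exists (act g v) => //; exact/edge_act.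
by exists (act g^-1%g v); rewrite /pre /= ?actKV // -(edge_act g) actKV.
Qed.

Lemma boundary_pre g A :
  boundary ed A = (fun e => (act g e.1, act g e.2)) @` boundary ed (pre g A).
Proof.
apply/seteqP; split => [[u v] [/= uv h]|_ [[u v] [/= uv h] <-]]; last first.
  by split => //=; exact/edge_act.
exists (act g^-1%g u, act g^-1%g v); last by rewrite /= !actKV.
by split; rewrite /pre /= ?actKV // -(edge_act g) !actKV.
Qed.

Lemma finite_boundary_pre g A : finite_set (boundary ed (pre g A)) <->
  finite_set (boundary ed A).
Proof.
have H h B : finite_set (boundary ed (pre h B)) -> finite_set (boundary ed B).
  by rewrite (boundary_pre h B); exact: finite_image.
by split; [exact: H|move=> fA; apply: (H g^-1%g); rewrite preKV].
Qed.

Lemma cost_pre g A : finite_set (boundary ed A) -> cost ed (pre g A) = cost ed A.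
Proof.
move=> fA; rewrite /cost (boundary_pre g A) card_image_inj //.
  by move=> [u v] [u' v'] [/act_inj -> /act_inj ->].
exact/finite_boundary_pre.
Qed.

Definition push g (x : set (set W)) : set (set W) := [set B | x (pre g^-1%g B)].

Lemma push_ultra g x : UltraFilter x -> UltraFilter (push g x).
Proof. exact: ultra_preimage. Qed.

Lemma pushK g x : push g^-1%g (push g x) = x.
Proof. by apply/seteqP; split => A; rewrite /push /= preK. Qed.

Lemma mincut_pre g x y A : mincut ed x y A -> mincut ed (push g x) (push g y) (pre g A).
Proof.
move=> [fA xA yA minA]; split.
- exact/finite_boundary_pre.
- by rewrite /push /= preKV.
- by rewrite /push /= preKV.
- move=> B fB xB yB; rewrite cost_pre // -(cost_pre g^-1%g fB); apply: minA => //.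
  exact/finite_boundary_pre.
Qed.

Lemma thin_pre g A : thin ed n A -> thin ed n (pre g A).
Proof.
move=> [x [y [xU yU mA cA]]]; exists (push g x), (push g y); split.
- exact: push_ultra.
- exact: push_ultra.
- exact: mincut_pre.
- by have [fA _ _ _] := mA; rewrite cost_pre.
Qed.

Lemma crossing_pre g A B : crossing (pre g A) (pre g B) <-> crossing A B.
Proof.
have H h A' B' : crossing A' B' -> crossing (pre h A') (pre h B').
  by move=> [[a [? ?]] [b [? ?]] [c [? ?]] [d [? ?]]]; split;
    [exists (act h^-1%g a)|exists (act h^-1%g b)|exists (act h^-1%g c)|
     exists (act h^-1%g d)]; rewrite /pre; split; rewrite /= actKV.
by split; [move=> /(H g^-1%g); rewrite !preKV|exact: H].
Qed.

Lemma crossers_pre g A : crossers ed n (pre g A) = pre g @` crossers ed n A.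
Proof.
apply/seteqP; split => [B [tB AB]|_ [B [tB AB] <-]]; last first.
  by split; [exact: thin_pre|exact/crossing_pre].
exists (pre g^-1%g B); last exact: preK.
split; first exact: thin_pre.
by apply/(crossing_pre g); rewrite preK.
Qed.

Lemma pre_inj g : injective (pre g).
Proof. by move=> A B /(congr1 (pre g^-1%g)); rewrite !preKV. Qed.

Lemma card_crossers_pre g A : thin ed n A ->
  card (crossers ed n (pre g A)) = card (crossers ed n A).
Proof.
move=> tA; rewrite crossers_pre card_image_inj //; first exact: pre_inj.
exact: crossers_finite.
Qed.

Lemma family_pre g A : E A -> E (pre g A).
Proof.
move=> [x [y [xU yU [mA cA oA]]]]; exists (push g x), (push g y).
split; [exact: push_ultra|exact: push_ultra|]; split.
- exact: mincut_pre.
- by have [fA _ _ _] := mA; rewrite cost_pre.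
- move=> B mB; have tA : thin ed n A by exists x, y.
  have mB' : mincut ed x y (pre g^-1%g B).
    by have := mincut_pre g^-1%g mB; rewrite !pushK.
  (* Thinness makes the crossers of [B] finite, so that translation preserves their number. *)
  have tB : thin ed n B.
    exists (push g x), (push g y); split => //; try exact: push_ultra.
    have [fA xA yA minA] := mA; have [fB xB yB minB] := mB.
    apply: leq_trans (cA); rewrite -(cost_pre g fA); apply: minB.
    + exact/finite_boundary_pre.
    + by rewrite /push /= preKV.
    + by rewrite /push /= preKV.
  rewrite card_crossers_pre // -(card_crossers_pre g^-1%g tB).
  exact: oA.
Qed.

(** * The star of a vertex of the structure tree *)

Hypothesis family_nonempty : E !=set0.

Lemma family_dense u : exists2 A, E A & spot A u.
Proof.
have [A EA] := family_nonempty; have [v sv] := family_spot EA.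
have [g gu] := transitive_act u v; exists (pre g A); first exact: family_pre.
by apply/spot_pre; rewrite gu.
Qed.

Notation orientE := (orient E).

Lemma orient_pre g A B : orientE (pre g A) (pre g B) <-> orientE A B.
Proof.
have H h A' B' : orientE A' B' -> orientE (pre h A') (pre h B').
  move=> [EB hB]; split; first exact: family_pre.
  case: hB => [AB|[BA nBA]]; [left; exact: pre_sub|right].
  by split; [move=> u; exact: BA|move=> e; apply: nBA; exact: (@pre_inj h _ _ e)].
by split; [move=> /(H g^-1%g); rewrite !preKV|exact: H].
Qed.

Lemma orient_eq_pre g A B : orientE A = orientE B ->
  orientE (pre g A) = orientE (pre g B).
Proof.
by move=> AB; apply/seteqP; split => C; rewrite -[C](preK g) !orient_pre AB.
Qed.

(** Unless [C = B], a neighbour of [b] outside [B] belongs to [C] by [orient_disjoint]; so the way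
    from [b] to [v], beyond [C], passes near the boundary of [C]. *)
Lemma orient_spot_near A B b v : E A -> E B -> orientE A = orientE B ->
  spot B b -> forall C c, E C -> orientE C = orientE A -> spot C c -> ~ C v ->
  dist (pi b) (pi c) + dist (pi c) (pi v) <=
  dist (pi b) (pi v) + (R + D + r + R).*2.
Proof.
move=> EA EB AB sb C c EC CA sc Cv; have [CB|CB] := EM (C = B).
  rewrite -CB in sb; have := spots_le (family_thin EC) sb sc.
  by have := dist_tri (pi b) (pi c) (pi v); rewrite (dist_sym (pi c) (pi b)); lia.
have [_ [b' [_ Bb' _ bb']]] := spot_neighbour sb.
have BC : ~` B `<=` C.
  apply: (orient_disjoint family_compl family_proper EB EC).
    by rewrite CA AB.
  by move=> e; apply: CB.
have := thin_near (family_thin EC) sc (BC b' Bb') Cv.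
have := dist_tri (pi b') (pi b) (pi c); have := dist_tri (pi b) (pi b') (pi v).
by rewrite (dist_sym (pi b') (pi b)); lia.
Qed.

Let near_const := (R + D + r + R).*2 + (r + D).*2.

(** A cut through a lift of [t] is screened by an incident cut [C], beyond which there is a point
    [v] near [t]. The geodesics from [a] and [b] to [v] both pass near [c]; as [t] is between [a]
    and [b], the sum of the two estimates puts [c] near [t]. *)
Lemma orient_spots_dense A B a b t : E A -> E B -> orientE A = orientE B ->
  spot A a -> spot B b -> between (pi a) t (pi b) ->
  exists C c, [/\ E C, orientE C = orientE A, spot C c & dist (pi c) t <= near_const].
Proof.
move=> EA EB AB sa sb bt; have [u tu] := coarsely_onto t.
have [D0 ED0 sD0] := family_dense u.
wlog AD0 : D0 ED0 sD0 / orientE A D0.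
  move=> H; have [h|h] := orientP family_compl family_nested EA ED0; first exact: (H D0).
  by apply: (H (~` D0)) => //; [exact: family_compl|exact/spotC].
have [C [EC CA CD0]] := orient_below family_compl family_proper family_nested
  family_interval EA AD0.
have [_ [v [_ Dv _ uv]]] := spot_neighbour sD0.
have Cv : ~ C v by move=> /CD0.
have [c sc] := family_spot EC; exists C, c; split => //.
have h1 := orient_spot_near EA EA erefl sa EC CA sc Cv.
have h2 := orient_spot_near EA EB AB sb EC CA sc Cv.
move: bt; rewrite /between /near_const => bt.
have h3 := dist_tri (pi c) (pi a) (pi b); have h4 := dist_tri t (pi a) (pi v).
have h5 := dist_tri t (pi b) (pi v); have h6 := dist_tri (pi u) t (pi v).
have h7 := dist_sym t (pi b); have h8 := dist_sym (pi c) (pi b).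
have h9 := dist_tri (pi v) (pi c) t; have h10 := dist_sym (pi v) t.
lia.
Qed.

(* The positions of the cuts incident to the vertex [orient A]. *)
Definition star A := [set u | exists2 B, E B /\ orientE B = orientE A & spot B u].

(** Otherwise some family cut also divides the star into two infinite parts and, up to complement,
    there is an incident cut [C] inside it. But a point of the star outside [C] is a spot of [C],
    and there are only finitely many of these. *)
Lemma star_one_ended A a b : E A -> adj a b ->
  finite_set (star A `&` pull a b) \/ finite_set (star A `&` ~` pull a b).
Proof.
move=> EA ab; apply: contrapT => /not_orP[i1 i2].
have [D0 [ED0 j1 j2]] := infinite_separation ab i1 i2.
wlog AD0 : D0 ED0 j1 j2 / orientE A D0.
  move=> H; have [h|h] := orientP family_compl family_nested EA ED0; first exact: (H D0).
  by apply: (H (~` D0)); rewrite ?setCK //; exact: family_compl.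
have [C [EC CA CD0]] := orient_below family_compl family_proper family_nested
  family_interval EA AD0.
have [c sc] := family_spot EC; apply: j2.
apply: (sub_finite_set _ (balls_finite (pi c) R)) => u [[B [EB BA] su] Du] /=.
have Cu : ~ C u by move=> /CD0.
have [BC|BC] := EM (C = B); first by rewrite -BC in su; exact: spots_le (family_thin EC) _ _ su sc.
have sBC : ~` B `<=` C.
  by apply: (orient_disjoint family_compl family_proper EB EC);
    [rewrite CA BA|move=> e; apply: BC].
have Bu : B u by apply: contrapT => /sBC.
have [v uv hv] := su; have Cv : C v by apply: sBC => Bv; apply: hv.
by apply: (spots_le (family_thin EC)) sc; exists v => // -[_ /(_ Cv)].
Qed.

(** The half-tree starting at [t] towards [b] separates [a] from [b], so its translate separates the
    images, and a geodesic between these meets the translated boundary. Since edges are invariant,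
    that boundary comes from edges near [t]. *)
Lemma quasi_geodesic a b c t k g : between (pi a) t (pi b) -> dist (pi c) t <= k ->
  exists s, between (pi (act g a)) s (pi (act g b)) /\
    dist (pi (act g c)) s <= L * (r + k) + L + D.
Proof.
move=> bt ct; have lip u v j : dist (pi u) (pi v) <= j ->
    dist (pi (act g u)) (pi (act g v)) <= L * j + L.
  move=> h; apply: leq_trans (act_lipschitz _ _ _) _.
  by rewrite leq_add2r leq_mul2l h orbT.
have [tb|tb] := EM (t = pi b).
  exists (pi (act g b)); split; first by rewrite /between dist0 addn0.
  have cb : dist (pi c) (pi b) <= r + k by rewrite -tb; lia.
  by have := lip c b _ cb; lia.
have [|q tq qb] := @dist_mid _ t (pi b) 1.
  by case E1 : (dist t (pi b)) => //; case: tb; exact: dist_eq0.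
have tq' := adj_dist tq; pose H := pull t q.
have Hb : H b.
  rewrite /H /pull /half /= (dist_sym (pi b) q) (dist_sym (pi b) t) qb.
  by case E1 : (dist t (pi b)) => [|m]; [case: tb; exact: dist_eq0|lia].
have Ha : ~ H a.
  rewrite /H /pull /half /=; have := dist_tri q (pi a) (pi b); move: bt.
  rewrite /between qb; case E1 : (dist t (pi b)) => [|m]; last by lia.
  by case: tb; exact: dist_eq0.
have [||||s [v [w [bs Av Aw sv vw]]]] := between_split coarsely_onto
  (A := pre g^-1%g H) (t := pi (act g b)) (t' := pi (act g a)) (u := act g b)
  (u' := act g a); rewrite ?dist0 /pre /= ?actK //.
have vw' : ed (act g^-1%g v, act g^-1%g w) by apply/edge_act/close_edge.
have [vt _] := edge_pull tq' vw' Av Aw.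
exists s; split.
  move: bs; rewrite /between (dist_sym s) (dist_sym _ s).
  by rewrite (dist_sym _ (pi (act g a))); lia.
have := lip (act g^-1%g v) c (r + k); rewrite actKV => h.
have := dist_tri (pi v) (pi (act g c)) s; rewrite (dist_sym (pi v) s).
rewrite (dist_sym (pi (act g c)) (pi v)).
suff h1 : dist (pi (act g^-1 v)) (pi c) <= r + k by have := h h1; lia.
apply: leq_trans (dist_tri t _ _) _; rewrite leq_add //.
by rewrite dist_sym.
Qed.

Let u0_exists : exists u0 : W, True.
Proof. by have [t0] := tree_nonempty T; have [u0 _] := coarsely_onto t0; exists u0. Qed.

(** Only finitely many triples [(A, a, b)] live near [u], so the bounds from [star_one_ended] have a
    maximum. *)
Lemma star_bound u k : exists N, forall A a b, E A -> spot A u -> adj a b ->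
  dist (pi u) a <= k -> dist (pi u) b <= k ->
  (forall v, star A v -> pull a b v -> dist (pi u) (pi v) <= N) \/
  (forall v, star A v -> ~ pull a b v -> dist (pi u) (pi v) <= N).
Proof.
pose good (X : set W * (vertex T * vertex T)) := [/\ E X.1, spot X.1 u &
  [/\ adj X.2.1 X.2.2, dist (pi u) X.2.1 <= k & dist (pi u) X.2.2 <= k]].
have fgood : finite_set good.
  apply: (@sub_finite_set _ _ ([set A | thin ed n A /\
      exists2 v, spot A v & dist (pi v) (pi u) <= 0] `*`
      ([set a | dist (pi u) a <= k] `*` [set a | dist (pi u) a <= k]))).
    move=> [A [a b]] [/= EA sA [_ ? ?]]; split => //=.
    by split; [exact: family_thin|exists u => //; rewrite dist0].
  apply: finite_setX; first exact: thin_finite.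
  by apply: finite_setX; exact: ball_finite.
have ch (X : set W * (vertex T * vertex T)) : exists N, good X ->
  (forall v, star X.1 v -> pull X.2.1 X.2.2 v -> dist (pi u) (pi v) <= N) \/
  (forall v, star X.1 v -> ~ pull X.2.1 X.2.2 v -> dist (pi u) (pi v) <= N).
  have [gX|ng] := EM (good X); last by exists 0 => /ng.
  have [EX sX [aX _ _]] := gX; have [fin|fin] := star_one_ended EX aX;
    have [N hN] := finite_bounded (fun v => dist (pi u) (pi v)) fin;
    exists N => _; [left|right]; by move=> v *; exact: hN.
have [f fP] := choice ch.
have [N hN] := finite_bounded f fgood; exists N => A a b EA sA ab ua ub.
have gX : good (A, (a, b)) by [].
have /= le := hN _ gX.
have [/= h|/= h] := fP _ gX; [left|right] => v sv hv; exact: leq_trans (h v sv hv) le.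
Qed.

(* The midpoint of two remote points of a star is close to a third point of the
   star, which can be moved to [u0]; after that, an edge of [T] near [u0] cuts
   the star into two parts reaching far away, and there are only finitely many
   stars near [u0] to consider in [star_bound]. *)
Lemma star_bounded : exists M, forall A B a b, E A -> E B -> orientE A = orientE B ->
  spot A a -> spot B b -> dist (pi a) (pi b) <= M.
Proof.
have [u0 _] := u0_exists; pose k := L * (r + near_const) + L + D.
have [N hN] := star_bound u0 k.+1.
(* Half of this exceeds the distance from which [act g] could bring an end within [N + k] of
   [u0]. *)
exists (L * (N + k) + L + near_const).*2.+1 => A B a b EA EB AB sa sb.
rewrite leqNgt; apply/negP => far.
have [|t at_ tb] := @dist_mid _ (pi a) (pi b) (dist (pi a) (pi b))./2; first by lia.
have bt : between (pi a) t (pi b) by rewrite /between at_ tb; lia.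
have [C [c [EC CA sc ct]]] := orient_spots_dense EA EB AB sa sb bt.
have [g gc] := transitive_act c u0.
have [s [bs cs]] := quasi_geodesic g bt ct; rewrite gc -/k in cs.
have farther x : L * (N + k) + L + near_const < dist (pi x) t ->
    N + k < dist (pi u0) (pi (act g x)).
  move=> xt; rewrite ltnNge; apply/negP => h; move: xt; apply/negP; rewrite -leqNgt.
  have := dist_tri (pi c) (pi x) t.
  have := act_lipschitz g^-1%g (act g x) (act g c); rewrite !actK gc.
  rewrite (dist_sym (pi (act g x))) => h1 h2.
  have : L * dist (pi u0) (pi (act g x)) <= L * (N + k) by rewrite leq_mul2l h orbT.
  lia.
have fa : N + k < dist (pi u0) (pi (act g a)) by apply: farther; lia.
have fb : N + k < dist (pi u0) (pi (act g b)).
  by apply: farther; rewrite dist_sym; lia.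
have h0 := dist_tri s (pi u0) (pi (act g b)).
have [|q sq qb] := @dist_mid _ s (pi (act g b)) 1; first by lia.
have sq' := adj_dist sq.
have Hb : pull s q (act g b).
  rewrite /pull /half /= (dist_sym _ q) (dist_sym _ s) qb; lia.
have Ha : ~ pull s q (act g a).
  rewrite /pull /half /=; have := dist_tri q (pi (act g a)) (pi (act g b)); move: bs.
  rewrite /between qb; lia.
have spot_g S x : spot S x -> spot (pre g^-1%g S) (act g x).
  by move=> h; apply/spot_pre; rewrite actK.
have EC' : E (pre g^-1%g C) by exact: family_pre.
have sC' : spot (pre g^-1%g C) u0 by rewrite -gc; exact: spot_g.
have uq : dist (pi u0) q <= k.+1 by have := dist_tri s (pi u0) q; lia.
have star_g S x : E S -> orientE S = orientE C -> spot S x ->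
    star (pre g^-1%g C) (act g x).
  move=> ES SC sx; exists (pre g^-1%g S); last exact: spot_g.
  by split; [exact: family_pre|exact: orient_eq_pre].
have [h|h] := hN _ _ _ EC' sC' sq' (leqW cs) uq.
  by have := h _ (star_g B b EB _ sb) Hb; rewrite CA AB => /(_ erefl); lia.
by have := h _ (star_g A a EA _ sa) Ha; rewrite CA => /(_ erefl); lia.
Qed.

(** * The structure tree, its action and its map to [T] *)

Variable M : nat.
Hypothesis star_le : forall A B a b, E A -> E B -> orientE A = orientE B ->
  spot A a -> spot B b -> dist (pi a) (pi b) <= M.

Definition cut_tree := structure_tree family_nonempty family_compl family_proper
  family_nested family_interval.
Let S := cut_tree.
Implicit Types (s t : vertex S).

Definition node_cut s : set W := projT1 (cid2 (nodeP (s : node E))).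

Lemma node_cutP s : E (node_cut s) /\ node_set s = orientE (node_cut s).
Proof. by rewrite /node_cut; case: cid2. Qed.

Let cutE s := proj1 (node_cutP s).
Let cut_orient s := proj2 (node_cutP s).

(** Any spot of any incident cut would do: by [star_le] the choice matters only up to [M]. *)
Definition pos s : W := projT1 (cid (family_spot (cutE s))).

Lemma pos_spot s : spot (node_cut s) (pos s).
Proof. by rewrite /pos; case: cid. Qed.

Lemma pos_near s A a : E A -> node_set s = orientE A -> spot A a ->
  dist (pi (pos s)) (pi a) <= M.
Proof.
move=> EA sA sa; apply: (star_le (cutE s) EA) => //; last exact: pos_spot.
by rewrite -cut_orient.
Qed.

Lemma pos_adj s t : adj s t -> dist (pi (pos s)) (pi (pos t)) <= M.*2.
Proof.
move=> /asboolP[A [EA sA tA]]; have [a sa] := family_spot EA.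
have := pos_near EA sA sa; have := pos_near (family_compl EA) tA (proj2 (spotC A a) sa).
by have := dist_tri (pi a) (pi (pos s)) (pi (pos t)); rewrite (dist_sym (pi a)); lia.
Qed.

Lemma pos_lipschitz s t : dist (pi (pos s)) (pi (pos t)) <= M.*2 * dist s t.
Proof. exact: (dist_lipschitz (f := pi \o pos) pos_adj). Qed.

(** [pre] pulls back, whence the inverse; [node_act_orient] gives independence of the chosen cut. *)
Definition node_act g s : vertex S := node_of (family_pre g^-1%g (cutE s)).

Lemma node_act_orient g s A : E A -> node_set s = orientE A ->
  node_set (node_act g s) = orientE (pre g^-1%g A).
Proof. by move=> EA sA; apply: orient_eq_pre; rewrite -cut_orient. Qed.

Lemma node_act1 s : node_act 1%g s = s.
Proof.
by apply: node_eq; rewrite (node_act_orient _ (cutE s) (cut_orient s)) invg1 pre1.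
Qed.

Lemma node_actM g h s : node_act (g * h)%g s = node_act g (node_act h s).
Proof.
apply: node_eq; rewrite (node_act_orient _ (cutE s) (cut_orient s)) invgM preM.
rewrite (@node_act_orient g (node_act h s) (pre h^-1%g (node_cut s))) //.
exact/family_pre/cutE.
Qed.

Lemma node_act_adj g s t : adj s t -> adj (node_act g s) (node_act g t).
Proof.
move=> /asboolP[A [EA sA tA]]; apply/asboolP; exists (pre g^-1%g A); split.
- exact: family_pre.
- exact: node_act_orient.
- by rewrite (node_act_orient _ (family_compl EA) tA).
Qed.

Lemma node_act_dist g s t : dist (node_act g s) (node_act g t) = dist s t.
Proof.
have H h u v : dist (node_act h u) (node_act h v) <= dist u v.
  rewrite -[X in _ <= X]mul1n; apply: dist_lipschitz => u' v' u'v'.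
  by rewrite dist_adj // node_act_adj.
apply/eqP; rewrite eqn_leq H /=.
by have := H g^-1%g (node_act g s) (node_act g t); rewrite -!node_actM mulVg !node_act1.
Qed.

Lemma node_act_inj g : injective (node_act g).
Proof.
by move=> s t /(congr1 (node_act g^-1%g)); rewrite -!node_actM mulVg !node_act1.
Qed.

Lemma pos_act g s : dist (pi (pos (node_act g s))) (pi (act g (pos s))) <= M.
Proof.
apply: pos_near (node_act_orient g (cutE s) (cut_orient s)) _; first exact/family_pre/cutE.
by apply/spot_pre; rewrite actK; exact: pos_spot.
Qed.

Lemma pos_dense u : exists s, dist (pi (pos s)) (pi u) <= M.
Proof.
by have [A EA su] := family_dense u; exists (node_of EA : vertex S); exact: pos_near su.
Qed.

Lemma pos_finite (p : vertex T) k : finite_set [set s | dist (pi (pos s)) p <= k].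
Proof.
apply: (finite_set_inj (f := node_cut) _ _ (thin_finite p k)).
  by move=> s st; split; [exact/family_thin/cutE|exists (pos s) => //; exact: pos_spot].
by move=> s s' _ _ e; apply: node_eq; rewrite !cut_orient e.
Qed.

Lemma pos_act_near g u s t k : act g (pos s) = u -> dist (pi (pos s)) (pi (pos t)) <= k ->
  dist (pi (pos (node_act g t))) (pi u) <= L * k + L + M.
Proof.
move=> gu st; apply: leq_trans (dist_tri (pi (act g (pos t))) _ _) _.
rewrite addnC leq_add ?pos_act // -gu dist_sym.
by apply: leq_trans (act_lipschitz _ _ _) _; rewrite leq_add2r leq_mul2l st orbT.
Qed.

(** Moving the position of [s] to [u0] sends the neighbours of [s] injectively into a finite set
    independent of [s]. *)
Lemma cut_tree_valence : bounded_valence S.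
Proof.
have [u0 _] := u0_exists.
have [N fN] := pos_finite (pi u0) (L * M.*2 + L + M).
exists N => s; have [g gs] := transitive_act (pos s) u0.
apply: card_le_trans (_ : (_ #<= [set t | dist (pi (pos t)) (pi u0) <= L * M.*2 + L + M])%card) _;
  last by have /card_eqPle[] := fN.
apply: card_le_trans (subset_card_le _) (card_ge_preimage (f := node_act g) _).
  by move=> t st; apply: pos_act_near gs _; exact: pos_adj.
by move=> t t' _ _; exact: node_act_inj.
Qed.

Lemma pos_close k : exists N, forall s t,
  dist (pi (pos s)) (pi (pos t)) <= k -> dist s t <= N.
Proof.
have [u0 _] := u0_exists; pose k' := L * k + L + M.
have fF := pos_finite (pi u0) k'.
have [N hN] := finite_bounded (fun p => dist p.1 p.2) (finite_setX fF fF).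
exists N => s t st; have [g gs] := transitive_act (pos s) u0.
rewrite -(node_act_dist g); apply: (hN (node_act g s, node_act g t)); split => /=.
  by apply: (pos_act_near gs); rewrite dist0.
exact: (pos_act_near gs).
Qed.

(** Nodes attached to consecutive vertices of a geodesic of [T] have positions at most
    [(M + D) + 1 + (M + D)] apart, so [pos_close] bounds their distance. *)
Lemma pos_expansive : exists N, forall s t,
  dist s t <= N * dist (pi (pos s)) (pi (pos t)) + N.
Proof.
have [N hN] := pos_close (M + D).*2.+1; exists N => s t.
have near p : exists s, dist p (pi (pos s)) <= M + D.
  have [u pu] := coarsely_onto p; have [s' su] := pos_dense u; exists s'.
  by have := dist_tri (pi u) p (pi (pos s')); rewrite (dist_sym (pi u)); lia.
suff H p q s' t' : dist p (pi (pos s')) <= M + D -> dist q (pi (pos t')) <= M + D ->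
    dist s' t' <= N * (dist p q).+1.
  rewrite addnC -mulnS; apply: H; rewrite dist0; exact: leq0n.
move E1 : (dist p q) => m; elim: m p s' E1 => [|m IH] p s' E1 ps qt.
  rewrite muln1; apply: hN; rewrite -(dist_eq0 E1) in qt.
  by have := dist_tri p (pi (pos s')) (pi (pos t')); rewrite (dist_sym _ p); lia.
have [|p' pp' pq'] := @dist_mid _ p q 1; first by lia.
have [s'' ps''] := near p'; rewrite mulnS.
apply: leq_trans (dist_tri s'' _ _) _; apply: leq_add; last first.
  by apply: (IH p') => //; lia.
apply: hN; have := dist_tri p (pi (pos s')) (pi (pos s'')).
by have := dist_tri p' p (pi (pos s'')); rewrite (dist_sym _ p); lia.
Qed.

(** * Ends and branching of the structure tree *)

Let nonprincipal (x : set (set W)) := UltraFilter x /\ forall F, finite_set F -> ~ x F.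

(** The star is bounded, so only finitely many cuts are incident to the vertex, and if [x] contained
    them all it would contain their intersection. This is finite: each of its points is close to a
    point outside some incident cut, hence close to the star. *)
Lemma ultra_below A x : nonprincipal x -> E A ->
  exists C, [/\ E C, orientE C = orientE A & ~ x C].
Proof.
move=> [xU xF] EA; apply: contrapT => noC.
pose F := [set C | E C /\ orientE C = orientE A].
have [a sa] := family_spot EA.
have fF : finite_set F.
  apply: (sub_finite_set _ (thin_finite (pi a) M)) => C [EC CA].
  split; first exact: family_thin.
  by have [c sc] := family_spot EC; exists c => //; exact: star_le sc sa.
have xI : x (\bigcap_(C in F) C).
  rewrite -(fset_setK fF); apply: filter_bigI => C.
  rewrite in_fset_set // inE => -[EC CA]; apply: contrapT => xC; apply: noC.
  by exists C.
apply: (xF _ _ xI); apply: (sub_finite_set _ (balls_finite (pi a) (r + (R + D).*2 + M))).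
move=> u uI /=; have [D0 ED0 sD0] := family_dense u.
wlog AD0 : D0 ED0 sD0 / orientE A D0.
  move=> H; have [h|h] := orientP family_compl family_nested EA ED0; first exact: (H D0).
  by apply: (H (~` D0)) => //; [exact: family_compl|exact/spotC].
have [C [EC CA CD0]] := orient_below family_compl family_proper family_nested
  family_interval EA AD0.
have [_ [v [_ Dv _ uv]]] := spot_neighbour sD0.
have Cv : ~ C v by move=> /CD0.
have [c sc] := family_spot EC; have Cu : C u by exact: uI.
have := thin_near (family_thin EC) sc Cu Cv.
by have := star_le EC EA CA sc sa; have := dist_tri (pi c) (pi u) (pi a); lia.
Qed.

Lemma node_arm A s t x : E A -> node_set s = orientE A -> node_set t = orientE (~` A) ->
  nonprincipal x -> ~ x A -> arm s t.
Proof.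
move=> EA sA tA [xU xF] xA; split; first by apply/asboolP; exists A.
(* The first two summands force a distance above [N] in the structure tree; the others keep [u] away
   from the boundary of [A]. *)
move=> N; pose K := M.*2 * N + M + (r + (R + D).*2) + M.
have [u Au far] : exists2 u, ~ A u & K < dist (pi u) (pi (pos s)).
  apply: contrapT => no; apply: (xF _ (balls_finite (pi (pos s)) K)).
  apply: filterS (proj2 (ultraC A) xA) => u Au /=; rewrite leqNgt; apply/negP => h.
  by apply: no; exists u.
have [B EB sB] := family_dense u; pose h : vertex S := node_of EB; exists h.
  apply: (structure_half EA sA tA) => -[_ hB].
  have [a sa] := family_spot EA; have as_ := pos_near EA sA sa.
  have [v1 [v2 [Bv1 Bv2 uv1 uv2]]] := spot_neighbour sB.
  have [v Av uv] : exists2 v, A v & dist (pi u) (pi v) <= r.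
    case: hB => [BA|[AB _]]; first by exists v1 => //; exact: BA.
    by exists v2 => //; apply: contrapT => /AB.
  have := thin_near (family_thin EA) sa Av Au; have := dist_tri (pi a) (pi u) (pi (pos s)).
  have := dist_sym (pi v) (pi u); have := dist_sym (pi a) (pi u).
  by have := dist_sym (pi a) (pi (pos s)); move: far; rewrite /K; lia.
rewrite ltnNge; apply/negP => sh; have := pos_lipschitz s h.
have hu : dist (pi (pos h)) (pi u) <= M by exact: pos_near sB.
have : M.*2 * dist s h <= M.*2 * N by rewrite leq_mul2l sh orbT.
have := dist_tri (pi (pos h)) (pi (pos s)) (pi u); rewrite (dist_sym (pi (pos s)) (pi u)).
by move: far; rewrite /K; lia.
Qed.

Let apart (x y z : set (set W)) := exists A, [/\ E A, ~ x A, y A & z A].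

(** The vertex is the median of the three ends. It starts from a minimal cut [A1] with [x2] and [x3]
    on one side and [x1] on the other. If the incident cut [A2] excluded [x3] as well as [x2], its
    complement would compete with [A1], hence equal it, which orientation forbids. So the cuts
    excluding [x1], [x2], [x3] are distinct. *)
Lemma branching_ultra x1 x2 x3 : nonprincipal x1 -> nonprincipal x2 -> nonprincipal x3 ->
  apart x1 x2 x3 -> apart x2 x1 x3 -> exists s, branching s.
Proof.
move=> n1 n2 n3 [A0 [EA0 xA1 xA2 xA3]] [B0 [EB0 xB2 xB1 xB3]].
have [[xU1 _] [xU2 _] [xU3 _]] := And3 n1 n2 n3.
pose F := [set C | [/\ E C, C `<=` A0, ~ x1 C, x2 C & x3 C]].
have fF : finite_set F.
  apply: (sub_finite_set _ (family_interval (family_compl EB0) EA0)) => C [EC CA Cx1 Cx2 Cx3].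
  split => //; split => //; case: (E_nestedP family_nested EC EB0) => h.
  - by case: xB2; exact: filterS Cx2.
  - by case: (ultra_disjoint h Cx3).
  - by move: h => /subsetC; rewrite setCK.
  - by case: (ultra_disjoint h (proj2 (ultraC C) Cx1)).
have [|A1 [EA1 A10 x1A1 x2A1 x3A1] minA1] := finite_min fF.
  by exists A0; split => //; exact: subset_refl.
have B0A1 : orientE A1 B0.
  split => //; right; split; last by move=> e; move: x3A1; rewrite -e ultraC.
  case: (E_nestedP family_nested EA1 EB0) => h.
  - by case: xB2; exact: filterS x2A1.
  - by case: (ultra_disjoint h x3A1).
  - by move: h => /subsetC; rewrite setCK.
  - by case: (ultra_disjoint h (proj2 (ultraC A1) x1A1)).
have [A2 [EA2 A21 A2B0]] := orient_below family_compl family_proper family_nested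
  family_interval EA1 B0A1.
have x2A2 : ~ x2 A2 by move=> h; apply: xB2; exact: filterS h.
have A12 : A1 <> A2 by move=> e; rewrite e in x2A1.
have sA12 : ~` A1 `<=` A2.
  exact: (orient_disjoint family_compl family_proper EA1 EA2 (esym A21) A12).
have x3A2 : x3 A2.
  apply: contrapT => x3A2.
  have e : ~` A2 = A1.
    have sA21 : ~` A2 `<=` A1 by move: sA12 => /subsetC; rewrite setCK.
    apply: minA1 => //; split; [exact: family_compl|exact: subset_trans A10| | |].
    - by rewrite ultraC; apply; apply: filterS sA12 _; exact/ultraC.
    - exact/ultraC.
    - exact/ultraC.
  have := orientN family_compl family_proper EA1 (orient_refl EA1).
  by rewrite -{2}e setCK -A21; apply; exact: orient_refl.
have [A3 [EA3 A31 x3A3]] := ultra_below n3 EA1.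
pose s : vertex S := node_of EA1.
pose t A (EA : E A) : vertex S := node_of (family_compl EA).
have t_neq A B (EA : E A) (EB : E B) : orientE A = orientE B -> A <> B -> t _ EA <> t _ EB.
  move=> AB nAB /(congr1 (@node_set _ _)) /= e.
  have : orientE (~` A) B.
    by apply: orient_flip => //; [rewrite AB; exact: orient_refl|move=> e'; apply: nAB].
  by rewrite e; exact: orientC_neq family_compl family_proper _ EB.
exists s, (t _ EA1), (t _ EA2), (t _ EA3); split; split.
- by apply: t_neq.
- by apply: t_neq => // e; rewrite -e in x3A3.
- by apply: t_neq => //; [rewrite A21 A31|move=> e; rewrite -e in x3A3].
- exact: (node_arm EA1 _ _ n1).
- exact: (node_arm EA2 _ _ n2).
- exact: (node_arm EA3 _ _ n3).
Qed.

(** A cut separating two ends has the third on one side, so it isolates one of the two. Applied to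
    suitable pairs, this isolates two different ends. *)
Lemma cut_tree_branching : (exists v : vertex T, branching v) -> exists s, branching s.
Proof.
move=> [v [w1 [w2 [w3 [[w12 w13 w23] [a1 a2 a3]]]]]].
have end_ w : arm v w -> exists x, nonprincipal x /\ x (pull v w).
  by move=> /arm_infinite/ultra_infinite[x [xU xH xF]]; exists x.
have [x1 [n1 h1]] := end_ _ a1; have [x2 [n2 h2]] := end_ _ a2.
have [x3 [n3 h3]] := end_ _ a3.
have sep x y w w' : nonprincipal x -> nonprincipal y -> arm v w -> arm v w' ->
    w <> w' -> x (pull v w) -> y (pull v w') -> exists A, [/\ E A, x A & ~ y A].
  move=> [xU _] [yU _] [vw _] [vw' _] ww' xw yw'; apply: family_separates xw _ => //.
  move=> yw; have yI : y (pull v w `&` pull v w') by exact: filterI.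
  have [u [/= u1 u2]] := @filter_ex _ y _ _ yI.
  exact: (half_apart vw vw' ww' u1 u2).
have cases x y z : nonprincipal x -> nonprincipal y -> nonprincipal z ->
    (exists A, [/\ E A, x A & ~ y A]) -> apart x y z \/ apart y x z.
  move=> [xU _] [yU _] [zU _] [A [EA xA yA]].
  have [zA|zA] := EM (z A); [right; exists A|left; exists (~` A)]; split => //.
  - exact: family_compl.
  - by rewrite ultraC.
  - exact/ultraC.
  - exact/ultraC.
have apartC x y z : apart x y z -> apart x z y by move=> [A [? ? ? ?]]; exists A.
have [p1|p2] := cases x1 x2 x3 n1 n2 n3 (sep _ _ _ _ n1 n2 a1 a2 w12 h1 h2).
  have [p2|p3] := cases x2 x3 x1 n2 n3 n1 (sep _ _ _ _ n2 n3 a2 a3 w23 h2 h3).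
    by apply: (branching_ultra n1 n2 n3) => //; exact: apartC.
  by apply: (branching_ultra n1 n3 n2) => //; exact: apartC.
have [p1|p3] := cases x1 x3 x2 n1 n3 n2 (sep _ _ _ _ n1 n3 a1 a3 w13 h1 h3).
  by apply: (branching_ultra n1 n2 n3) => //; exact: apartC.
by apply: (branching_ultra n2 n3 n1) => //; exact: apartC.
Qed.

Lemma cut_tree_bushy : (exists v : vertex T, branching v) ->
  exists K, forall s, exists2 t, branching t & dist s t <= K.
Proof.
move=> /cut_tree_branching[s0 bs0]; have [N hN] := pos_close M; exists N => s.
have [g gs] := transitive_act (pos s0) (pos s); exists (node_act g s0).
  exact: (branching_isometry (node_act_dist g)).
by rewrite dist_sym; apply: hN; rewrite -gs; exact: pos_act.
Qed.

Lemma cut_tree_spec : (exists v : vertex T, branching v) ->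
  exists (S' : simplicial_tree) (sact : G -> vertex S' -> vertex S')
    (pos' : vertex S' -> W) (K : nat),
  [/\ bounded_valence S', forall u : vertex S', exists2 v, branching v & dist u v <= K,
      forall u, sact 1%g u = u,
      forall g h u, sact (g * h)%g u = sact g (sact h u) &
      forall g u v, adj u v -> adj (sact g u) (sact g v)] /\
  [/\ forall u v, dist (pi (pos' u)) (pi (pos' v)) <= K * dist u v,
      forall u v, dist u v <= K * dist (pi (pos' u)) (pi (pos' v)) + K,
      forall p, exists u, dist p (pi (pos' u)) <= K &
      forall g u, dist (pi (pos' (sact g u))) (pi (act g (pos' u))) <= K].
Proof.
move=> br; have [K1 bushy] := cut_tree_bushy br; have [K2 expa] := pos_expansive.
exists cut_tree, node_act, pos, (K1 + K2 + M.*2 + D); split; split.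
- exact: cut_tree_valence.
- move=> s; have [t bt st] := bushy s; exists t => //.
  by rewrite -!addnA; apply: leq_trans st (leq_addr _ _).
- exact: node_act1.
- exact: node_actM.
- exact: node_act_adj.
- by move=> s t; apply: leq_trans (pos_lipschitz s t) _; apply: leq_mul => //; lia.
- by move=> s t; apply: leq_trans (expa s t) _; apply: leq_add; [apply: leq_mul => //|]; lia.
- move=> p; have [u pu] := coarsely_onto p; have [s su] := pos_dense u; exists s.
  by have := dist_tri (pi u) p (pi (pos s)); rewrite (dist_sym (pi u)); lia.
- by move=> g s; have := pos_act g s; lia.
Qed.

End CutsOfGSet.

Theorem gset_tree (T : simplicial_tree) (G : groupType) (W : choiceType)
    (act : G -> W -> W) (pi : W -> vertex T) (L D : nat) :
  bounded_valence T -> (exists v : vertex T, branching v) ->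
  (forall u, act 1%g u = u) -> (forall g h u, act (g * h)%g u = act g (act h u)) ->
  (forall u v, exists g, act g u = v) ->
  (forall t, finite_set [set u | pi u = t]) ->
  (forall g u v, dist (pi (act g u)) (pi (act g v)) <= L * dist (pi u) (pi v) + L) ->
  (forall t, exists u, dist t (pi u) <= D) ->
  exists (S : simplicial_tree) (sact : G -> vertex S -> vertex S)
    (pos : vertex S -> W) (K : nat),
  [/\ bounded_valence S, forall s : vertex S, exists2 t, branching t & dist s t <= K,
      forall s, sact 1%g s = s,
      forall g h s, sact (g * h)%g s = sact g (sact h s) &
      forall g s t, adj s t -> adj (sact g s) (sact g t)] /\
  [/\ forall s t, dist (pi (pos s)) (pi (pos t)) <= K * dist s t,
      forall s t, dist s t <= K * dist (pi (pos s)) (pi (pos t)) + K,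
      forall t, exists s, dist t (pi (pos s)) <= K &
      forall g s, dist (pi (pos (sact g s))) (pi (act g (pos s))) <= K].
Proof.
move=> bv br act1 actM tr fib lip onto.
have [n hn] := pull_cost bv act1 actM fib lip onto tr.
have [R hR] := thin_spots act1 actM lip onto n.
have ne := branching_family_nonempty L onto hn br.
have [M hM] := star_bounded bv act1 actM fib lip onto tr hn hR ne.
exact: (cut_tree_spec bv act1 actM fib lip onto tr hn hR ne hM br).
Qed.

(** * The coset space of a quasi-action on a tree *)

Section QuasiAction.
Variables (T : simplicial_tree) (G : groupType) (a : G -> vertex T -> vertex T).
Variables (K : nat) (x0 w1 w2 w3 : vertex T).
Hypothesis T_valence : bounded_valence T.
Hypothesis a_lipschitz : forall g u v, dist (a g u) (a g v) <= K * dist u v + K.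
Hypothesis aM : forall g h u, dist (a g (a h u)) (a (g * h)%g u) <= K.
Hypothesis a1 : forall u, dist (a 1%g u) u <= K.
Hypothesis a_cobounded : forall u v, exists g, dist v (a g u) <= K.
Hypotheses (w12 : w1 <> w2) (w13 : w1 <> w3) (w23 : w2 <> w3).
Hypotheses (arm1 : arm x0 w1) (arm2 : arm x0 w2) (arm3 : arm x0 w3).

Let aV g v : dist (a g (a g^-1%g v)) v <= K.*2.
Proof.
have h1 := aM g g^-1%g v; have h2 := a1 v; rewrite mulgV in h1.
by have := dist_tri (a 1%g v) (a g (a g^-1%g v)) v; lia.
Qed.

Lemma half_infinite w : arm x0 w -> infinite_set (half x0 w).
Proof.
move=> [_ far] fin; have [N hN] := finite_bounded (dist x0) fin.
by have [h /hN h1 h2] := far N; lia.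
Qed.

Lemma half_close w u v : adj x0 w -> half x0 w u -> ~ half x0 w v ->
  dist u x0 <= dist u v /\ dist v x0 <= dist u v.
Proof.
move=> xw hu hv; have := half_cross xw hu hv; have := dist_tri w u x0.
by have := dist_adj xw; rewrite (dist_sym x0 w) (dist_sym v x0); lia.
Qed.

(** The image of the half-tree under [g], written as a preimage because [a g] need not be
    bijective. *)
Definition translate g w : set (vertex T) := [set v | half x0 w (a g^-1%g v)].

Definition almost_eq {U : Type} (S S' : set U) := finite_set [set v | ~ (S v <-> S' v)].

Lemma almost_eq_refl {U : Type} (S : set U) : almost_eq S S.
Proof.
rewrite /almost_eq (_ : [set _ | _] = set0) //; apply/seteqP.
by split => // v /= h; case: h.
Qed.

Lemma almost_eq_sym {U : Type} (S S' : set U) : almost_eq S S' -> almost_eq S' S.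
Proof. by apply: sub_finite_set => v /= h h'; apply: h; rewrite h'. Qed.

Lemma almost_eq_trans {U : Type} (S2 S1 S3 : set U) :
  almost_eq S1 S2 -> almost_eq S2 S3 -> almost_eq S1 S3.
Proof.
move=> h1 h2; apply: (@sub_finite_set _ _ ([set v | ~ (S1 v <-> S2 v)] `|`
   [set v | ~ (S2 v <-> S3 v)])); last by rewrite finite_setU.
by move=> v /= h; have [h12|] := EM (S1 v <-> S2 v); [right; rewrite -h12|left].
Qed.

(** The bound of [near_base] for [k = K.*2], where [K.*2] bounds the image of an edge. *)
Let R0 := K * K.*2 + K.*2 + K.

Lemma near_base g v k : dist (a g^-1%g v) x0 <= k -> dist v (a g x0) <= K * k + K.*2 + K.
Proof.
move=> h; have h1 := aV g v; have h2 := a_lipschitz g (a g^-1%g v) x0.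
have h3 : K * dist (a g^-1%g v) x0 <= K * k by rewrite leq_mul2l h orbT.
by have := dist_tri (a g (a g^-1%g v)) v (a g x0); rewrite (dist_sym v (a g (a _ _))); lia.
Qed.

Let id_onto : forall t : vertex T, exists u, dist t u <= 0.
Proof. by move=> t; exists t; rewrite dist0. Qed.

Lemma translate_located g w : arm x0 w -> located id 0 (a g x0) R0 (translate g w).
Proof.
move=> [xw _] v v' hv hv' vv'; have := half_close xw hv hv'.
have := a_lipschitz g^-1%g v v'.
have : K * dist v v' <= K * 1 by rewrite leq_mul2l vv' orbT.
move=> h1 h2 [h3 h4]; rewrite /R0; split; apply: near_base; lia.
Qed.

Definition tripod := [set w | [\/ w = w1, w = w2 | w = w3]].

Lemma tripod_arm w : tripod w -> arm x0 w.
Proof. by case=> ->. Qed.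

(** If [c] were far from [x0], two of the half-trees would avoid [c]. The translate has its boundary
    near [c], so it contains both or is disjoint from both; it cannot almost coincide with just one
    of them. *)
Lemma translate_fix g : (forall w, tripod w -> almost_eq (translate g w) (half x0 w)) ->
  dist (a g x0) x0 <= R0.
Proof.
move=> fixg; rewrite leqNgt; apply/negP => far; set c := a g x0 in far *.
have side w w' : arm x0 w -> arm x0 w' -> ~ half x0 w' c ->
    forall v, half x0 w' v -> (translate g w v <-> translate g w x0).
  move=> aw aw' cw' v vw'; have loc := translate_located (g := g) aw.
  have := half_cross (proj1 aw') vw' cw'; have := dist_tri w' v x0.
  have := dist_adj (proj1 aw'); rewrite (dist_sym x0 w') (dist_sym x0 c) => h1 h2 h3.
  split => hv; apply: contrapT => hx.
    by have := located_near id_onto loc hv hx; rewrite /c in far h3 *; lia.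
  have := located_near id_onto loc hv hx; rewrite /= (dist_sym x0) (dist_sym _ v).
  by rewrite (dist_sym x0 v) /c in far h3 *; lia.
have contra w w' : w <> w' -> tripod w -> tripod w' -> ~ half x0 w c -> ~ half x0 w' c -> False.
  move=> ww' tw tw' cw cw'; have [aw aw'] := (tripod_arm tw, tripod_arm tw').
  have [v vw tv] : exists2 v, half x0 w v & translate g w v.
    apply: contrapT => no; apply: (half_infinite aw).
    by apply: sub_finite_set (fixg w tw) => v vw [_ /(_ vw)] tv; apply: no; exists v.
  apply: (half_infinite aw'); apply: sub_finite_set (fixg w tw) => u uw' [+ _].
  have tu : translate g w u.
    by apply/(side w w' aw aw' cw' u uw')/(side w w aw aw cw v vw).
  by move=> /(_ tu) uw; exact: (half_apart (proj1 aw) (proj1 aw') ww' uw uw').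
have excl w w' : w <> w' -> arm x0 w -> arm x0 w' -> half x0 w c -> ~ half x0 w' c.
  by move=> ww' aw aw' cw cw'; exact: (half_apart (proj1 aw) (proj1 aw') ww' cw cw').
have [t1 t2 t3] : [/\ tripod w1, tripod w2 & tripod w3].
  by split; [constructor 1|constructor 2|constructor 3].
have [c1|c1] := EM (half x0 w1 c).
  exact: (contra w2 w3 w23 t2 t3 (excl _ _ w12 arm1 arm2 c1) (excl _ _ w13 arm1 arm3 c1)).
have [c2|c2] := EM (half x0 w2 c).
  exact: (contra w1 w3 w13 t1 t3 c1 (excl _ _ w23 arm2 arm3 c2)).
exact: (contra w1 w2 w12).
Qed.

(* Fixing the ends in each of three half-trees coarsely fixes [x0], by
   [translate_fix], and is a condition on finitely many located sets, which makes
   the set of classes locally finite. *)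
Definition equiv g h := forall w, tripod w -> almost_eq (translate g w) (translate h w).

Lemma almost_eq_near (S S' : set (vertex T)) c k : (forall v, ~ (S v <-> S' v) -> dist v c <= k) ->
  almost_eq S S'.
Proof.
move=> h; apply: sub_finite_set (ball_finite c k T_valence) => v /= /h.
by rewrite dist_sym.
Qed.

Lemma half_near w u v k : arm x0 w -> ~ (half x0 w u <-> half x0 w v) -> dist u v <= k ->
  dist u x0 <= k.
Proof.
move=> [xw _] nuv uv; have [hu|hu] := EM (half x0 w u).
  have hv : ~ half x0 w v by tauto.
  by have [] := half_close xw hu hv; lia.
have hv : half x0 w v by apply: contrapT; tauto.
by have [] := half_close xw hv hu; rewrite (dist_sym v u); lia.
Qed.

(** The two sets differ only where a bounded error crosses the edge between [x0] and [w]. So modulo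
    finite sets the quasi-action becomes an action. *)
Lemma translateM g h w : arm x0 w ->
  almost_eq (translate (g * h)%g w) (a g^-1%g @^-1` translate h w).
Proof.
move=> aw; apply: (@almost_eq_near _ _ (a (g * h)%g x0) (K * K + K.*2 + K)) => v nv.
apply: near_base; apply: half_near aw nv _.
by rewrite dist_sym invgM; exact: aM.
Qed.

Lemma almost_eq_preimage g S S' : almost_eq S S' ->
  almost_eq (a g^-1%g @^-1` S) (a g^-1%g @^-1` S').
Proof.
move=> fin; apply: (@sub_finite_set _ _
  (\bigcup_(p in [set v | ~ (S v <-> S' v)]) [set v | dist (a g p) v <= K.*2])).
  by move=> v /= nv; exists (a g^-1%g v) => //; exact: aV.
by apply: bigcup_finite => // p _; exact: ball_finite.
Qed.

Lemma equiv_refl g : equiv g g.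
Proof. by move=> w _; exact: almost_eq_refl. Qed.

Lemma equiv_sym g h : equiv g h -> equiv h g.
Proof. by move=> gh w tw; exact/almost_eq_sym/gh. Qed.

Lemma equiv_trans h g k : equiv g h -> equiv h k -> equiv g k.
Proof. by move=> gh hk w tw; exact: almost_eq_trans (gh w tw) (hk w tw). Qed.

(** By this left invariance the classes are the left cosets of a subgroup. *)
Lemma equivM k g h : equiv g h -> equiv (k * g)%g (k * h)%g.
Proof.
move=> gh w tw; have aw := tripod_arm tw.
apply: almost_eq_trans (translateM k g aw) _.
apply: almost_eq_trans (almost_eq_preimage k (gh w tw)) _.
exact/almost_eq_sym/translateM.
Qed.

Let R1 := K * R0 + K.*2.

Lemma equiv_near g h : equiv g h -> dist (a g x0) (a h x0) <= R1.
Proof.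
move=> /(equivM h^-1%g); rewrite mulVg => e.
have near : dist (a (h^-1 * g)%g x0) x0 <= R0.
  apply: translate_fix => w tw; apply: almost_eq_trans (e w tw) _.
  apply: (@almost_eq_near _ _ x0 (K + K)) => v nv.
  have h1 : dist (a (1%g)^-1%g v) v <= K by rewrite invg1.
  have h2 : dist (a (1%g)^-1%g v) x0 <= K := half_near (tripod_arm tw) nv h1.
  by have := dist_tri (a (1%g)^-1%g v) v x0; rewrite (dist_sym v (a _ v)); lia.
have h1 := aM h (h^-1 * g)%g x0; rewrite mulgA mulgV mul1g in h1.
have h2 := a_lipschitz h (a (h^-1 * g)%g x0) x0.
have h3 : K * dist (a (h^-1 * g)%g x0) x0 <= K * R0 by rewrite leq_mul2l near orbT.
have := dist_tri (a h (a (h^-1 * g)%g x0)) (a g x0) (a h x0).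
by rewrite (dist_sym (a g x0) (a h (a _ _))) /R1; lia.
Qed.

Record coset := Coset { coset_set : set G; cosetP : exists g, coset_set = equiv g }.

HB.instance Definition _ := gen_eqMixin coset.
HB.instance Definition _ := gen_choiceMixin coset.

Definition class_of g : coset := Coset (ex_intro _ g erefl).

Lemma class_eq g h : equiv g h -> class_of g = class_of h.
Proof.
move=> gh; rewrite /class_of.
have e : equiv g = equiv h.
  by apply/seteqP; split => k; [exact/equiv_trans/equiv_sym|exact: equiv_trans].
case: _ / e (ex_intro _ _ _) (ex_intro _ _ _) => p q; congr Coset; exact: Prop_irrelevance.
Qed.

Definition repr (c : coset) : G := projT1 (cid (cosetP c)).

Lemma reprK c : class_of (repr c) = c.
Proof.
rewrite /repr; case: cid => g; case: c => S p /= e; subst S; congr Coset.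
exact: Prop_irrelevance.
Qed.

Lemma repr_class g : equiv (repr (class_of g)) g.
Proof.
rewrite /repr; case: cid => h /= e; have : equiv g h by rewrite e; exact: equiv_refl.
exact: equiv_sym.
Qed.

Definition coset_act g c := class_of (g * repr c)%g.

Definition coset_pos c := a (repr c) x0.

Lemma coset_act_near g c : dist (coset_pos (coset_act g c)) (a g (coset_pos c)) <= R1 + K.
Proof.
have h1 := equiv_near (repr_class (g * repr c)%g).
have h2 := aM g (repr c) x0.
by have := dist_tri (a (g * repr c)%g x0) (coset_pos (coset_act g c)) (a g (coset_pos c));
  rewrite (dist_sym (a _ x0) (a g _)) /coset_act /coset_pos; lia.
Qed.

Lemma quasi_action_tree : exists (S : simplicial_tree) (sact : G -> vertex S -> vertex S)
    (f : vertex S -> vertex T) (N : nat),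
  [/\ bounded_valence S, forall s : vertex S, exists2 t, branching t & dist s t <= N,
      forall s, sact 1%g s = s,
      forall g h s, sact (g * h)%g s = sact g (sact h s) &
      forall g s t, adj s t -> adj (sact g s) (sact g t)] /\
  [/\ forall s t, dist (f s) (f t) <= N * dist s t,
      forall s t, dist s t <= N * dist (f s) (f t) + N,
      forall t, exists s, dist t (f s) <= N &
      forall g s, dist (f (sact g s)) (a g (f s)) <= N].
Proof.
(* The constant [(R1 + K).*2 + K] adds two errors of [coset_act_near] to that of [a g]; [R1 + K] is
   the coarse density of the positions. *)
have [||||||||S [sact [pos [N [[h1 h2 h3 h4 h5] [h6 h7 h8 h9]]]]]] :=
  @gset_tree T G coset coset_act coset_pos ((R1 + K).*2 + K) (R1 + K).
- exact: T_valence.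
- by exists x0, w1, w2, w3; split; split.
- by move=> c; rewrite /coset_act mul1g reprK.
- move=> g h c; apply: class_eq; rewrite -mulgA; apply: equivM.
  exact/equiv_sym/repr_class.
- move=> c d; exists (repr d * (repr c)^-1)%g.
  by rewrite /coset_act -mulgA mulVg mulg1 reprK.
- move=> t; pose L := [set A | located id 0 t R0 A].
  have fL : finite_set L.
    by apply: located_finite => // p r; apply: sub_finite_set (ball_finite p r T_valence) => u;
      rewrite /= dist_sym.
  apply: (finite_set_inj (f := fun c => (translate (repr c) w1, (translate (repr c) w2,
    translate (repr c) w3))) _ _ (finite_setX fL (finite_setX fL fL))).
    by move=> c /= ct; rewrite /L -ct; split; [|split]; exact: translate_located.
  move=> c d _ _ [e1 e2 e3]; rewrite -(reprK c) -(reprK d); apply: class_eq => w.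
  by case=> ->; rewrite ?e1 ?e2 ?e3; exact: almost_eq_refl.
- move=> g c d; have := coset_act_near g c; have := coset_act_near g d.
  have := a_lipschitz g (coset_pos c) (coset_pos d).
  have := dist_tri (a g (coset_pos c)) (coset_pos (coset_act g c)) (coset_pos (coset_act g d)).
  have := dist_tri (a g (coset_pos d)) (a g (coset_pos c)) (coset_pos (coset_act g d)).
  by rewrite (dist_sym (a g (coset_pos d)) (coset_pos _)); nia.
- move=> t; have [g tg] := a_cobounded x0 t; exists (class_of g).
  have := equiv_near (repr_class g); have := dist_tri (a g x0) t (coset_pos (class_of g)).
  by rewrite (dist_sym (a g x0)) /coset_pos; lia.
exists S, sact, (coset_pos \o pos), (N + (R1 + K)); split; split => //.
- by move=> s; have [t bt st] := h2 s; exists t => //; apply: leq_trans st (leq_addr _ _).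
- by move=> s t; apply: leq_trans (h6 s t) _; rewrite leq_mul2r leq_addr orbT.
- move=> s t; apply: leq_trans (h7 s t) _; apply: leq_add; last exact: leq_addr.
  by rewrite leq_mul2r leq_addr orbT.
- by move=> t; have [s ts] := h8 t; exists s; apply: leq_trans ts (leq_addr _ _).
- move=> g s; apply: leq_trans (dist_tri (coset_pos (coset_act g (pos s))) _ _) _.
  by apply: leq_add; [exact: h9|exact: coset_act_near].
Qed.

End QuasiAction.

(** * Geometric realizations *)

Import Order.TTheory GRing.Theory Num.Theory.
Import numFieldNormedType.Exports.
Local Open Scope ring_scope.

Section RealizationMetric.
Variables (R : realType) (T : simplicial_tree).
Implicit Types (x y : realization R T) (a b u v w h : vertex T) (s t : R).

Let vp := @vertex_point R T.

Lemma bary0 u v : bary u v 0 = bcoord (vp u) :> (vertex T -> R).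
Proof. by apply/funext => w; rewrite /= /bary; ring. Qed.

Lemma bary1 u v : bary u v 1 = bcoord (vp v) :> (vertex T -> R).
Proof. by apply/funext => w; rewrite /= /bary; ring. Qed.

Lemma baryC u v t : bary u v t = bary v u (1 - t) :> (vertex T -> R).
Proof. by apply/funext => w; rewrite /bary; ring. Qed.

Lemma bary_diag u t : bary u u t = bcoord (vp u) :> (vertex T -> R).
Proof. by apply/funext => w; rewrite /= /bary; ring. Qed.

Lemma point_on_edge x : (exists u, x = vp u) \/
  exists u v t, [/\ adj u v, 0 <= t <= 1 & bcoord x = bary u v t].
Proof.
have [u [v [t [[<-|uv] ht ex]]]] := bcoordP x; last by right; exists u, v, t.
by left; exists u; apply: point_eq; rewrite ex bary_diag.
Qed.

Lemma bary_sum (f : vertex T -> R) (S : seq (vertex T)) u v t : uniq S ->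
  u \in S -> v \in S ->
  \sum_(w <- S) bary u v t w * f w = (1 - t) * f u + t * f v.
Proof.
move=> US uS vS; have one p : p \in S -> \sum_(w <- S) (w == p)%:R * f w = f p.
  move=> pS; rewrite (bigD1_seq p) //= eqxx mul1r big1 ?addr0 // => w /negbTE ->.
  by rewrite mul0r.
under eq_bigr => w _ do rewrite /bary mulrDl -!mulrA.
by rewrite big_split /= -!mulr_sumr !one.
Qed.

(** Summing the coordinates against [f] over a list containing all four vertices shows that the
    affine extension does not depend on the edge chosen. *)
Lemma bary_eval (f : vertex T -> R) u v t u' v' t' :
  bary u v t = bary u' v' t' :> (vertex T -> R) ->
  (1 - t) * f u + t * f v = (1 - t') * f u' + t' * f v'.
Proof.
move=> e; pose S := undup [:: u; v; u'; v'].
have US : uniq S := undup_uniq _.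
rewrite -(bary_sum f t US) ?mem_undup ?inE ?eqxx ?orbT //.
by rewrite -(bary_sum f t' US) ?mem_undup ?inE ?eqxx ?orbT // e.
Qed.

Lemma affine_subproof (f : vertex T -> R) x : exists c : R, forall u v t,
  bcoord x = bary u v t -> c = (1 - t) * f u + t * f v.
Proof.
have [u [v [t [_ _ ex]]]] := bcoordP x; exists ((1 - t) * f u + t * f v) => u' v' t'.
by rewrite ex; exact: bary_eval.
Qed.

Definition affine (f : vertex T -> R) x : R := projT1 (cid (affine_subproof f x)).

Lemma affineE f x u v t : bcoord x = bary u v t ->
  affine f x = (1 - t) * f u + t * f v.
Proof. by rewrite /affine; case: cid => c /= h; exact: h. Qed.

Lemma affine_vertex f u : affine f (vp u) = f u.
Proof. by rewrite (@affineE f (vp u) u u 0) //; ring. Qed.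

Lemma polygonal_ge0 x y l : polygonal_path x y l -> 0 <= l.
Proof.
elim=> // {}x {}y z l' m [u [v [s [t [_ _ _ _ ->]]]]] _ IH.
by rewrite addr_ge0.
Qed.

Lemma mdist_le x y l : polygonal_path x y l -> mdist x y <= l.
Proof.
by move=> p; apply: ge_inf => //; exists 0 => m /polygonal_ge0.
Qed.

Lemma mdist_ge x y c : (forall l, polygonal_path x y l -> c <= l) -> c <= mdist x y.
Proof.
move=> h; have [ne|em] := EM ([set l | polygonal_path x y l] !=set0).
  exact: lb_le_inf.
(* The infimum of an empty set is [0]; then [x = y] by positivity, and the trivial path gives a
   contradiction. *)
have e : [set l | polygonal_path x y l] = set0.
  by apply/seteqP; split => // l pl; apply: em; exists l.
have e' : mdist x y = inf [set l | polygonal_path x y l] by [].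
have xy : x = y by apply: mdist_positivity; rewrite e' e inf0.
by case: em; exists 0; rewrite xy; exact: PolyNil.
Qed.

(** The source of lower bounds for the path metric: it suffices to test paths with affine
    functions. *)
Lemma affine_lipschitz f x y : (forall u v, adj u v -> `|f u - f v| <= 1) ->
  `|affine f x - affine f y| <= mdist x y.
Proof.
move=> flip; apply: mdist_ge => l; elim=> [{}x|{}x {}y z l' m seg _ IH].
  by rewrite subrr normr0.
rewrite -(subrK (affine f y) (affine f x)) -addrA.
apply: le_trans (ler_normD _ _) _; apply: lerD => //.
move: seg => [u [v [s [t [uv hs ht [ex ey] ->]]]]].
rewrite (affineE f ex) (affineE f ey).
have -> : (1 - s) * f u + s * f v - ((1 - t) * f u + t * f v) = (s - t) * (f v - f u).
  by ring.
by rewrite normrM ler_piMr // distrC; exact: flip.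
Qed.

Lemma mdist_edge x y u v s t : adj u v -> 0 <= s <= 1 -> 0 <= t <= 1 ->
  bcoord x = bary u v s -> bcoord y = bary u v t -> mdist x y <= `|s - t|.
Proof.
move=> uv hs ht ex ey; apply: mdist_le; rewrite -[X in polygonal_path _ _ X]addr0.
by apply: PolyCons (PolyNil _); exists u, v, s, t.
Qed.

Let unit0 : 0 <= (0 : R) <= 1. Proof. by rewrite lexx ler01. Qed.
Let unit1 : 0 <= (1 : R) <= 1. Proof. by rewrite ler01 lexx. Qed.

Definition vdist u v : R := (dist u v)%:R.

Lemma vdist_lipschitz w u v : adj u v -> `|vdist w u - vdist w v| <= 1.
Proof.
move=> uv; have h1 := dist_tri u w v; have h2 := dist_tri v w u.
rewrite (dist_sym v u) (dist_adj uv) in h2; rewrite (dist_adj uv) in h1.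
have e1 : vdist w u <= vdist w v + 1 by rewrite /vdist natr1 ler_nat; lia.
have e2 : vdist w v <= vdist w u + 1 by rewrite /vdist natr1 ler_nat; lia.
by rewrite ler_norml; apply/andP; split; lra.
Qed.

Lemma mdist_vertex u v : mdist (vp u) (vp v) = vdist u v.
Proof.
apply/eqP; rewrite eq_le; apply/andP; split; last first.
  have := affine_lipschitz (vp u) (vp v) (vdist_lipschitz u).
  by rewrite !affine_vertex /vdist dist0 sub0r normrN normr_nat.
rewrite /vdist; move E : (dist u v) => n; elim: n u E => [|n IH] u E.
  by rewrite (dist_eq0 E) mdistxx.
have [|w uw wv] := @dist_mid _ u v 1; first by lia.
rewrite -natr1 addrC; apply: le_trans (metric_triangle _ (vp w) _) _.
apply: lerD; last by apply: IH; lia.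
have := @mdist_edge (vp u) (vp w) u w 0 1 (adj_dist uw) unit0 unit1.
by rewrite bary0 bary1 sub0r normrN normr1; apply.
Qed.

Lemma vdist_edge w u v : adj u v ->
  vdist w v = vdist w u + 1 \/ vdist w u = vdist w v + 1.
Proof.
move=> uv; have := dist_tri u w v; have := dist_tri v w u.
rewrite (dist_sym v u) (dist_adj uv) => h1 h2; rewrite /vdist !natr1.
have ne := halfC w uv; rewrite /half /= in ne.
have [e|] : dist w v = (dist w u).+1 \/ dist w u = (dist w v).+1 by lia.
  by left; rewrite e.
by move=> e; right; rewrite e.
Qed.

(** Along an edge [vdist w] changes by exactly 1, so the route through the end nearer to [w] attains
    the lower bound. *)
Lemma mdist_affine w x : mdist (vp w) x = affine (vdist w) x.
Proof.
apply/eqP; rewrite eq_le; apply/andP; split; last first.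
  have := affine_lipschitz x (vp w) (vdist_lipschitz w).
  rewrite affine_vertex /vdist dist0 subr0 metric_sym.
  exact: le_trans (ler_norm _).
have [[u ->]|[u [v [t [uv ht ex]]]]] := point_on_edge x.
  by rewrite affine_vertex mdist_vertex.
have hu := @mdist_edge (vp u) x u v 0 t uv unit0 ht (esym (bary0 u v)) ex.
have hv := @mdist_edge (vp v) x u v 1 t uv unit1 ht (esym (bary1 u v)) ex.
have tu := metric_triangle (vp w) (vp u) x; have tv := metric_triangle (vp w) (vp v) x.
rewrite !mdist_vertex in tu tv; rewrite (affineE _ ex).
move: ht hu hv => /andP[t0 t1]; rewrite sub0r normrN !ger0_norm ?subr_ge0 // => hu hv.
by have [e|e] := vdist_edge w uv; rewrite e in tu tv *; lra.
Qed.

Lemma vertex_near x : exists v, mdist x (vp v) <= 1.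
Proof.
have [[u ->]|[u [v [t [uv /andP[t0 t1] ex]]]]] := point_on_edge x.
  by exists u; rewrite mdistxx.
exists u; have := @mdist_edge x (vp u) u v t 0 uv _ unit0 ex (esym (bary0 u v)).
rewrite t0 t1 subr0 ger0_norm // => /(_ isT); lra.
Qed.

(** * Complementary components of a vertex *)

Lemma bary_pos u v t h : 0 <= t <= 1 ->
  0 < bary u v t h <-> h = u /\ t < 1 \/ h = v /\ 0 < t.
Proof.
move=> /andP[t0 t1]; rewrite /bary.
have [->|hu] := eqVneq h u; have [e|hv] := eqVneq _ v; rewrite ?mulr1 ?mulr0 ?addr0 ?add0r.
- rewrite subrK ltr01; split => // _; have [t0'|t0'] := ltrP 0 t; first by right.
  by left; split => //; lra.
- by split; [left; split => //; lra|case=> [[_ ?]|[/eqP]]; [lra|rewrite (negbTE hv)]].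
- by split; [right|case=> [[/eqP]|[_]] //; rewrite (negbTE hu)].
- by rewrite ltxx; split => // -[[/eqP]|[/eqP]]; rewrite ?(negbTE hu) ?(negbTE hv).
Qed.

Lemma vertex_pos v h : 0 < bcoord (vp v) h -> h = v.
Proof. by rewrite -(bary_diag v 0) bary_pos ?lexx ?ler01 // => -[[]|[]]. Qed.

Lemma vertex_posx v : 0 < bcoord (vp v) v.
Proof. by rewrite -(bary_diag v 0) bary_pos ?lexx ?ler01 //; left. Qed.

Lemma near_pos x h : 0 < bcoord x h -> mdist x (vp h) <= 1.
Proof.
have [u [v [t [uv ht ex]]]] := bcoordP x; rewrite {1}ex bary_pos //.
case: uv => [e|uv].
  rewrite -e bary_diag in ex; have -> : x = vp u := point_eq ex.
  by move=> [[-> _]|[-> _]]; rewrite ?e mdistxx ler01.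
have [t0 t1] := andP ht.
move=> [[-> _]|[-> _]].
  apply: le_trans (mdist_edge uv ht unit0 ex (esym (bary0 u v))) _.
  by rewrite subr0 ger0_norm.
apply: le_trans (mdist_edge uv ht unit1 ex (esym (bary1 u v))) _.
by rewrite distrC ger0_norm ?subr_ge0 //; lra.
Qed.

(* As [v] and [w] are adjacent, the difference of the two distances is at most 1,
   and it is exactly 1 at [v] and on the side of [v]. *)
Definition branch v w : set (realization R T) :=
  [set x | mdist x (vp w) < mdist x (vp v) + 1].

Lemma vdist_half v w h : adj v w ->
  half v w h /\ vdist w h = vdist v h - 1 \/ ~ half v w h /\ vdist w h = vdist v h + 1.
Proof.
move=> vw; have := vdist_edge h vw; rewrite /vdist !(dist_sym h) => e.
have [hh|hh] := EM (half v w h); [left|right]; split => //.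
  have lt : (dist w h)%:R < (dist v h)%:R :> R.
    by rewrite ltr_nat !(dist_sym _ h).
  by case: e => e; lra.
case: e => // e; case: hh; rewrite /half /= !(dist_sym h) -(ltr_nat R) e.
by rewrite ltrDl ltr01.
Qed.

Lemma branch_pos v w x : adj v w ->
  branch v w x <-> exists2 h, half v w h & 0 < bcoord x h.
Proof.
move=> vw; have [a [b [t [_ ht ex]]]] := bcoordP x.
rewrite /branch /= !(metric_sym x) !mdist_affine !(affineE _ ex).
have [t0 t1] := andP ht.
split=> [lt|[h hh]].
  have [[ha _]|[ha ea]] := vdist_half a vw; have [[hb _]|[hb eb]] := vdist_half b vw.
  - have [t0'|t0'] := ltrP 0 t.
      by exists b => //; rewrite ex bary_pos //; right.
    by exists a => //; rewrite ex bary_pos //; left; split => //; lra.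
  - have [t1'|t1'] := ltrP t 1.
      by exists a => //; rewrite ex bary_pos //; left.
    have e1 : t = 1 by lra.
    by exfalso; rewrite e1 eb in lt; lra.
  - have [t0'|t0'] := ltrP 0 t.
      by exists b => //; rewrite ex bary_pos //; right.
    have e0 : t = 0 by lra.
    by exfalso; rewrite e0 ea in lt; lra.
  - by exfalso; rewrite ea eb in lt; lra.
have le1 p : vdist w p <= vdist v p + 1 by have [[_ ->]|[_ ->]] := vdist_half p vw; lra.
have lth : vdist w h = vdist v h - 1 by have [[_ ->]|[]] := vdist_half h vw.
rewrite ex bary_pos // => -[[e tt]|[e tt]]; rewrite e in lth; rewrite lth.
  by have := le1 b; nra.
by have := le1 a; nra.
Qed.

Lemma branch_open v w : open (branch v w).
Proof.
rewrite openE => x xB; apply/nbhs_ballP.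
exists ((mdist x (vp v) + 1 - mdist x (vp w)) / 2) => /=.
  by rewrite divr_gt0 // subr_gt0.
move=> y; rewrite ballEmdist /= /branch /= => xy.
have h1 := metric_triangle y x (vp w); have h2 := metric_triangle x y (vp v).
rewrite (metric_sym y x) in h1; lra.
Qed.

(** A common point would have support vertices in both half-trees, hence an edge leaving the first
    one; its outer end can only be [v], which is not in the second. *)
Lemma branch_disjoint v w w' x : adj v w -> adj v w' -> w <> w' ->
  branch v w x -> ~ branch v w' x.
Proof.
move=> vw vw' ww' /(branch_pos _ vw)[h hw xh] /(branch_pos _ vw')[h' hw' xh'].
have nh' : ~ half v w h' by move=> h'w; exact: (half_apart vw vw' ww' h'w hw').
have hh' : h <> h' by move=> e; rewrite e in hw.
have adjh : adj h h'.
  have [a [b [t [ab ht ex]]]] := bcoordP x; rewrite ex !bary_pos // in xh xh'.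
  case: xh xh' hh' => [[-> _]|[-> _]] [[-> _]|[-> _]] // ne.
    by case: ab.
  by rewrite adj_sym; case: ab => // e; case: ne.
have [_ e] := half_edge vw adjh hw nh'.
by move: hw'; rewrite e /half /= dist0.
Qed.

Lemma branch_cover v x : x <> vp v -> exists2 w, adj v w & branch v w x.
Proof.
move=> xv; have [h hv xh] : exists2 h, h <> v & 0 < bcoord x h.
  have [a [b [t [ab ht ex]]]] := bcoordP x; have [t0 t1] := andP ht.
  apply: contrapT => no.
  have pos h : h = a /\ t < 1 \/ h = b /\ 0 < t -> h = v.
    by move=> hp; apply: contrapT => hv; apply: no; exists h => //; rewrite ex bary_pos.
  apply: xv; apply: point_eq; rewrite ex.
  have [t1'|t1'] := ltrP t 1; last first.
    have e1 : t = 1 by lra.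
    by rewrite e1 bary1 (pos b) //; right; split => //; lra.
  rewrite (pos a); last by left.
  have [t0'|t0'] := ltrP 0 t; first by rewrite (pos b) ?bary_diag //; right.
  have e0 : t = 0 by lra.
  by rewrite e0 bary0.
have [|w vw wh] := @dist_mid _ v h 1.
  by case E : (dist v h) => //; case: hv; apply/esym/dist_eq0.
exists w; first exact: adj_dist.
apply/branch_pos; first exact: adj_dist.
exists h => //; rewrite /half /= !(dist_sym h) wh.
case E : (dist v h) => [|n]; last by rewrite subn1.
by case: hv; apply/esym/dist_eq0.
Qed.

(* Makes the parametrization of an edge continuous on the whole line. *)
Let clamp t : R := if t <= 0 then 0 else if 1 <= t then 1 else t.

Lemma clamp_itv t : 0 <= clamp t <= 1.
Proof. by rewrite /clamp; case: (leP t 0) => ?; [|case: (leP 1 t) => ?]; lra. Qed.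

Lemma clamp_id t : 0 <= t <= 1 -> clamp t = t.
Proof. by rewrite /clamp; case: (leP t 0) => ?; [|case: (leP 1 t) => ?]; lra. Qed.

Lemma clamp_lipschitz s t : `|clamp s - clamp t| <= `|s - t|.
Proof.
wlog st : s t / s <= t.
  move=> H; case/orP: (le_total s t) => [|ts]; first exact: H.
  by rewrite -normrN opprB -(normrN (s - t)) opprB; exact: H.
have /andP[h1 h2] : 0 <= clamp t - clamp s <= t - s.
  rewrite /clamp; apply/andP; case: (leP s 0) => ?; [|case: (leP 1 s) => ?];
  (case: (leP t 0) => ?; [|case: (leP 1 t) => ?]); split; lra.
have e : `|s - t| = t - s by rewrite distrC ger0_norm // subr_ge0.
by rewrite e distrC ger0_norm.
Qed.

Lemma edge_point_subproof a b t : adj a b -> exists u v s,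
  [/\ u = v \/ adj u v, 0 <= s <= 1 & bary a b (clamp t) = bary u v s].
Proof. by move=> ab; exists a, b, (clamp t); split; [right|exact: clamp_itv|]. Qed.

Definition edge_point a b (ab : adj a b) t : realization R T :=
  Realization_point (edge_point_subproof t ab).

Lemma edge_point_continuous a b (ab : adj a b) : continuous (edge_point ab).
Proof.
move=> t; apply/cvg_ballP => e e0; near=> s; rewrite ballEmdist /=.
apply: le_lt_trans (_ : `|t - s| < e).
  apply: le_trans (clamp_lipschitz t s).
  exact: (mdist_edge ab (clamp_itv t) (clamp_itv s)).
by near: s; apply/nbhs_ballP; exists e.
Unshelve. all: by end_near. Qed.

Lemma segment_component (A : set (realization R T)) a b s t x y :
  adj a b -> 0 <= s -> s <= t -> t <= 1 -> bcoord x = bary a b s -> bcoord y = bary a b t ->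
  (forall z r, s <= r <= t -> bcoord z = bary a b r -> A z) ->
  connected_component A x y.
Proof.
move=> ab s0 st t1 ex ey hA.
have itv r : s <= r <= t -> clamp r = r by move=> ?; apply: clamp_id; lra.
exists (edge_point ab @` `[s, t]); last first.
  exists t => /=; first by rewrite in_itv /= st lexx.
  by apply: point_eq; rewrite /= itv ?st ?lexx.
split.
- exists s => /=; first by rewrite in_itv /= lexx st.
  by apply: point_eq; rewrite /= itv ?lexx ?st.
- move=> z [r /=]; rewrite in_itv /= => hr <-; apply: (hA _ r) => //=.
  by rewrite itv.
- apply: connected_continuous_connected; first exact: segment_connected.
  by apply: continuous_subspaceT => r; exact: edge_point_continuous.
Qed.

Lemma pos_neq v h x : h <> v -> 0 < bcoord x h -> (~` [set vp v]) x.
Proof. by move=> hv xh /= e; apply: hv; apply: vertex_pos; rewrite -e. Qed.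

Lemma branch_vertex v w h : adj v w -> half v w h ->
  connected_component (~` [set vp v]) (vp w) (vp h).
Proof.
move=> vw; have half_neq u : half v w u -> u <> v.
  by move=> + e; rewrite e /half /= dist0.
move E : (dist h w) => n; elim: n h E => [|n IH] h E hh.
  rewrite (dist_eq0 E); apply: connected_component_refl.
  apply: (@pos_neq _ w); last exact: vertex_posx.
  by move: hh; rewrite (dist_eq0 E); exact: half_neq.
have [|h1 hh1 h1w] := @dist_mid _ h w 1; first by lia.
have hh1' : half v w h1.
  by move: hh; rewrite /half /=; have := dist_tri h1 h v; lia.
apply: connected_component_trans (IH h1 _ hh1') _; first by lia.
have h1h : adj h1 h by rewrite adj_sym; exact: adj_dist.
apply: (segment_component h1h (lexx 0) ler01 (lexx 1)).
- by rewrite bary0.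
- by rewrite bary1.
- move=> z r hr ez; have [r1|r1] := ltrP r 1.
    by apply: (pos_neq (half_neq _ hh1')); rewrite ez bary_pos //; left.
  by apply: (pos_neq (half_neq _ hh)); rewrite ez bary_pos //; right; split => //; lra.
Qed.

Lemma branch_component v w x : adj v w -> branch v w x ->
  connected_component (~` [set vp v]) (vp w) x.
Proof.
move=> vw /(branch_pos _ vw)[h hh xh].
have hv : h <> v by move=> e; move: hh; rewrite e /half /= dist0.
apply: connected_component_trans (branch_vertex vw hh) _.
apply: connected_component_sym.
have [a [b [t [ab ht ex]]]] := bcoordP x.
have key a' t' : adj a' h -> 0 <= t' <= 1 -> bcoord x = bary a' h t' -> 0 < t' ->
    connected_component (~` [set vp v]) x (vp h).
  move=> ah /andP[t0 t1] ex' tp.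
  apply: (segment_component ah t0 t1 (lexx 1) ex') => [|z r hr ez]; first by rewrite bary1.
  by apply: (pos_neq hv); rewrite ez bary_pos; [right; split => //; lra|lra].
rewrite ex bary_pos // in xh; case: ab => [ab|ab].
  have e : x = vp h.
    by apply: point_eq; rewrite ex -ab bary_diag; case: xh => -[-> _]; rewrite -?ab.
  rewrite e; apply: connected_component_refl; apply: (pos_neq hv); exact: vertex_posx.
case: xh => -[e tp]; last by rewrite -e in ab ex; exact: key ab ht ex tp.
rewrite -e adj_sym in ab; rewrite -e baryC in ex.
by apply: (key _ _ ab _ ex); lra.
Qed.

(** Branches are connected and open, and they partition the complement of [v]; so each is also
    closed there. *)
Lemma component_branch v w : adj v w ->
  connected_component (~` [set vp v]) (vp w) = branch v w.
Proof.
move=> vw; apply/seteqP; split; last by move=> x; exact: branch_component.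
move=> x [C [Cw CA cC] Cx].
pose U := \bigcup_(w' in [set w' | adj v w' /\ w <> w']) branch v w'.
suff e : C `&` branch v w = C by move: Cx; rewrite -e => -[].
apply: cC.
- exists (vp w); split => //; rewrite /branch /= mdistxx mdist_vertex /vdist.
  by rewrite dist_sym (dist_adj vw); lra.
- by exists (branch v w) => //; exact: branch_open.
- exists (~` U).
    by apply: open_closedC; apply: bigcup_open => w' _; exact: branch_open.
  apply/seteqP; split => y [Cy] yB; split => //.
    by move=> [w' [vw' ww'] yB']; exact: (branch_disjoint vw vw' ww' yB yB').
  have [|w' vw' yB'] := @branch_cover v y; first by move=> e; apply: (CA y Cy).
  have [->//|ww'] := EM (w = w').
  by case: yB; exists w'.
Qed.

Let ucc v := @unbounded_complementary_components R T v.

Lemma branch_bounded v w M : adj v w -> (forall h, half v w h -> (dist v h <= M)%N) ->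
  metric_bounded (branch v w).
Proof.
move=> vw hM; have near x : branch v w x -> mdist x (vp v) <= M%:R + 1.
  move=> /(branch_pos _ vw)[h hh xh]; have := metric_triangle x (vp h) (vp v).
  have := near_pos xh; rewrite (mdist_vertex h) /vdist dist_sym.
  have : (dist v h)%:R <= M%:R :> R by rewrite ler_nat; exact: hM.
  by lra.
exists (M%:R + 1 + (M%:R + 1)) => x y /near xv /near yv.
by have := metric_triangle x (vp v) y; rewrite (metric_sym (vp v)); lra.
Qed.

Lemma ucc_arm v C : ucc v C -> exists2 w, arm v w & C = branch v w.
Proof.
move=> [[x xv ->] unb]; have [w vw xw] := branch_cover xv.
have e : connected_component (~` [set vp v]) x = branch v w.
  rewrite -component_branch //; apply/esym/same_connected_component.
  exact: branch_component.
rewrite e in unb *; exists w => //; split => // M; apply: contrapT => no.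
apply: unb; apply: (branch_bounded (M := M) vw) => h hh; rewrite leqNgt; apply/negP => Mh.
by apply: no; exists h.
Qed.

Lemma arm_ucc v w : arm v w -> ucc v (branch v w).
Proof.
move=> [vw far]; split.
  exists (vp w); last by rewrite -component_branch.
  by move=> /(congr1 (@bcoord R T))/(congr1 (@^~ w)) e;
    have := vertex_posx w; rewrite e => /vertex_pos e'; rewrite e' adj_irr in vw.
move=> [M bM]; have [h hh Mh] := far (Num.bound `|M|%R + 2)%N.
have wB : branch v w (vp w).
  rewrite -component_branch //; apply: branch_vertex => //.
  by rewrite /half /= dist0 dist_sym (dist_adj vw).
have hB : branch v w (vp h) by rewrite -component_branch //; exact: branch_vertex.
have := bM _ _ wB hB; apply/negP; rewrite -ltNge mdist_vertex /vdist.
have := dist_tri w v h; rewrite (dist_adj vw) => tri.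
apply: (@lt_le_trans _ _ (Num.bound `|M|)%:R); last by rewrite ler_nat; lia.
exact: le_lt_trans (ler_norm M) (archi_boundP (normr_ge0 M)).
Qed.

Lemma branch_neq v w w' : adj v w -> adj v w' -> w <> w' -> branch v w <> branch v w'.
Proof.
move=> vw vw' ww' e; have wB : branch v w (vp w).
  rewrite -component_branch //; apply: branch_vertex => //.
  by rewrite /half /= dist0 dist_sym (dist_adj vw).
by apply: (branch_disjoint vw vw' ww' wB); rewrite -e.
Qed.

Lemma branchingP v : branching v <-> (`I_3 #<= ucc v)%card.
Proof.
split=> [[w1 [w2 [w3 [[w12 w13 w23] [a1 a2 a3]]]]]|].
  apply/pcard_leP/injfunPex.
  exists (fun i => nth set0 [:: branch v w1; branch v w2; branch v w3] i).
    by move=> [|[|[|]]] //= _; exact: arm_ucc.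
  have [[b1 _] [b2 _] [b3 _]] := And3 a1 a2 a3.
  have [n12 n13 n23] := And3 (branch_neq b1 b2 w12) (branch_neq b1 b3 w13) (branch_neq b2 b3 w23).
  move=> i j; rewrite !inE /= => i3 j3.
  by case: i i3 => [|[|[|//]]] _; case: j j3 => [|[|[|//]]] _ //= e; exfalso;
    first [exact: n12|exact: n13|exact: n23|exact: (n12 (esym e))|
           exact: (n13 (esym e))|exact: (n23 (esym e))].
move=> /pcard_leP/injfunPex[f fun_f inj_f].
have [w1 a1 e1] := ucc_arm (fun_f 0%N isT); have [w2 a2 e2] := ucc_arm (fun_f 1%N isT).
have [w3 a3 e3] := ucc_arm (fun_f 2%N isT).
have neq i j w w' : `I_3 i -> `I_3 j -> i <> j -> f i = branch v w -> f j = branch v w' ->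
    w <> w'.
  by move=> i3 j3 ij ei ej e; apply: ij; apply: inj_f; rewrite ?inE // ei ej e.
by exists w1, w2, w3; split; split => //;
  [apply: (neq 0%N 1%N)|apply: (neq 0%N 2%N)|apply: (neq 1%N 2%N)].
Qed.

End RealizationMetric.

(** * The induced action on the realization *)

Section InducedAction.
Variables (R : realType) (T : simplicial_tree) (G : groupType).
Variable sact : G -> vertex T -> vertex T.
Hypothesis sact1 : forall v, sact 1%g v = v.
Hypothesis sactM : forall g h v, sact (g * h)%g v = sact g (sact h v).
Hypothesis sact_adj : forall g u v, adj u v -> adj (sact g u) (sact g v).

Lemma bary_sact g u v (t : R) :
  bary u v t \o sact g^-1%g = bary (sact g u) (sact g v) t.
Proof.
have e w p : (sact g^-1%g w == p) = (w == sact g p).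
  apply/eqP/eqP => [<-|->]; first by rewrite -sactM mulgV sact1.
  by rewrite -sactM mulVg sact1.
by apply/funext => w; rewrite /bary /= !e.
Qed.

Lemma induced_subproof g (x : realization R T) : exists u v t,
  [/\ u = v \/ adj u v, 0 <= t <= 1 & bcoord x \o sact g^-1%g = bary u v t].
Proof.
have [u [v [t [uv ht ->]]]] := bcoordP x; exists (sact g u), (sact g v), t.
by split; [case: uv => [->|/sact_adj]; [left|right]|exact: ht|exact: bary_sact].
Qed.

Definition induced g (x : realization R T) : realization R T :=
  Realization_point (induced_subproof g x).

Lemma induced_vertex g v : induced g (vertex_point R v) = vertex_point R (sact g v).
Proof. by apply: point_eq; rewrite /= bary_sact. Qed.

Lemma induced1 x : induced 1%g x = x.
Proof.
apply: point_eq; apply/funext => w /=; rewrite -[in RHS](sact1 w).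
by rewrite invg1.
Qed.

Lemma inducedM g h x : induced (g * h)%g x = induced g (induced h x).
Proof. by apply: point_eq; apply/funext => w /=; rewrite invgM sactM. Qed.

Lemma induced_polygonal g x y l :
  polygonal_path x y l -> polygonal_path (induced g x) (induced g y) l.
Proof.
elim=> [{}x|{}x {}y z l' m [u [v [s [t [uv hs ht [ex ey] ->]]]]] _ IH]; first exact: PolyNil.
apply: PolyCons IH; exists (sact g u), (sact g v), s, t; split => //.
  exact: sact_adj.
by rewrite /= ex ey !bary_sact.
Qed.

Lemma induced_isometry : isometric_action induced.
Proof.
split; [exact: induced1|exact: inducedM|].
have H g x y : mdist (induced g x) (induced g y) <= mdist x y.
  by apply: mdist_ge => l p; apply: mdist_le; exact: induced_polygonal.
move=> g x y; apply/eqP; rewrite eq_le H /=.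
by have := H g^-1%g (induced g x) (induced g y); rewrite -!inducedM mulVg !induced1.
Qed.

End InducedAction.

(** * Passing between points and vertices *)

Section Rounding.
Variables (R : realType) (T : simplicial_tree).

Definition round (x : realization R T) : vertex T := projT1 (cid (vertex_near x)).

Lemma roundP x : mdist x (vertex_point R (round x)) <= 1.
Proof. by rewrite /round; case: cid. Qed.

Lemma dist_round x y : (dist (round x) (round y))%:R <= mdist x y + 2.
Proof.
have hx := roundP x; have hy := roundP y.
have := mdist_vertex R (round x) (round y); rewrite /vdist => <-.
have := metric_triangle (vertex_point R (round x)) x (vertex_point R (round y)).
have := metric_triangle x y (vertex_point R (round y)).
by rewrite (metric_sym (vertex_point R (round x)) x); lra.
Qed.

Lemma mdist_round x y : mdist x y <= (dist (round x) (round y))%:R + 2.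
Proof.
have hx := roundP x; have hy := roundP y.
have := mdist_vertex R (round x) (round y); rewrite /vdist => <-.
have := metric_triangle x (vertex_point R (round x)) y.
have := metric_triangle (vertex_point R (round x)) (vertex_point R (round y)) y.
by rewrite (metric_sym (vertex_point R (round y)) y); lra.
Qed.

End Rounding.

Lemma nat_bound (R : realType) (c : R) : exists N : nat, c <= N%:R.
Proof.
exists (Num.bound `|c|); apply: le_trans (ler_norm c) _.
exact/ltW/archi_boundP/normr_ge0.
Qed.

Lemma ler_natM (R : realType) (N d : nat) (k x : R) :
  0 <= k -> k <= N%:R -> x <= d%:R -> k * x <= (N * d)%:R.
Proof.
move=> k0 kN xd; apply: le_trans (ler_wpM2l k0 xd) _.
by rewrite natrM ler_wpM2r.
Qed.

Section VertexQuasiAction.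
Variables (R : realType) (T : simplicial_tree) (G : groupType).
Variable A : G -> realization R T -> realization R T.
Let vp := @vertex_point R T.

Definition vertex_action g v := round (A g (vp v)).

Lemma vertex_action_quasi : quasi_action A -> cobounded A -> exists N : nat,
  [/\ forall g u v, (dist (vertex_action g u) (vertex_action g v) <= N * dist u v + N)%N,
      forall g h u,
        (dist (vertex_action g (vertex_action h u)) (vertex_action (g * h) u) <= N)%N,
      forall u, (dist (vertex_action 1 u) u <= N)%N &
      forall u v, exists g, (dist v (vertex_action g u) <= N)%N].
Proof.
move=> [K [C [K1 C0 QI A1 AM]]] [D hD].
have [nK hK] := nat_bound K; have [nC hC] := nat_bound C; have [nD hDn] := nat_bound D.
have K0 : 0 <= K := le_trans ler01 K1.
have lip g x y : mdist (A g x) (A g y) <= K * mdist x y + C.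
  by have [/(_ x y)/andP[_ ?] _] := QI g.
(* Composition costs [nK] for a rounding stretched by the quasi-isometry, [nC] twice, and 2 for
   final roundings; [nD] serves coboundedness. *)
pose N := (nK + nC + nC + nD + 2)%N.
have to_vertex x v : (dist (round x) v)%:R <= mdist x (vp v) + 1.
  have := metric_triangle (vp (round x)) x (vp v); rewrite mdist_vertex /vdist.
  by rewrite (metric_sym (vp _) x); have := roundP x; lra.
exists N; split.
- move=> g u v; rewrite -(ler_nat R) natrD.
  have h1 := dist_round (A g (vp u)) (A g (vp v)); have h2 := lip g (vp u) (vp v).
  rewrite mdist_vertex /vdist in h2.
  have h3 := ler_natM K0 hK (lexx (dist u v)%:R).
  have h4 : (nK * dist u v)%:R <= (N * dist u v)%:R :> R.
    by rewrite ler_nat leq_mul2r /N; apply/orP; right; lia.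
  have h5 : nC%:R + 2 <= N%:R :> R by rewrite -natrD ler_nat /N; lia.
  by rewrite /vertex_action; lra.
- move=> g h u; rewrite -(ler_nat R).
  have h1 := dist_round (A g (vp (vertex_action h u))) (A (g * h)%g (vp u)).
  have h2 := lip g (vp (vertex_action h u)) (A h (vp u)).
  have h3 := roundP (A h (vp u)); rewrite metric_sym in h3.
  have h4 := AM g h (vp u).
  have h5 := metric_triangle (A g (vp (vertex_action h u))) (A g (A h (vp u))) (A (g * h)%g (vp u)).
  have h6 : K * mdist (vp (vertex_action h u)) (A h (vp u)) <= K.
    by rewrite -[leRHS]mulr1; apply: ler_wpM2l.
  have h7 : nK%:R + nC%:R + nC%:R + 2 <= N%:R :> R by rewrite -!natrD ler_nat /N; lia.
  by rewrite /vertex_action in h1 h2 h5 h6 *; lra.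
- move=> u; rewrite -(ler_nat R); have := to_vertex (A 1%g (vp u)) u.
  rewrite A1 mdistxx => h; rewrite /vertex_action A1.
  have : 2 <= N%:R :> R by rewrite ler_nat /N; lia.
  by lra.
- move=> u v; have [g hg] := hD (vp u) (vp v); exists g; rewrite -(ler_nat R) dist_sym.
  have := to_vertex (A g (vp u)) v; rewrite metric_sym.
  have : nD%:R + 2 <= N%:R :> R by rewrite -natrD ler_nat /N; lia.
  by rewrite /vertex_action; lra.
Qed.

End VertexQuasiAction.

Section TreeMap.
Variables (R : realType) (S T : simplicial_tree) (N : nat) (f : vertex S -> vertex T).
Hypothesis f_lipschitz : forall s t, (dist (f s) (f t) <= N * dist s t)%N.
Hypothesis f_expansive : forall s t, (dist s t <= N * dist (f s) (f t) + N)%N.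
Hypothesis f_onto : forall t, exists s, (dist t (f s) <= N)%N.

Definition tree_map (x : realization R S) : realization R T := vertex_point R (f (round x)).

Lemma tree_map_quasi_isometry : quasi_isometry tree_map.
Proof.
have N0 : 0 <= N%:R :> R by exact: ler0n.
(* [N] may be [0], whereas the multiplicative constant must be at least 1. *)
exists (N%:R + 1), (3 * N%:R + 3); split; [lra|lra|split].
  move=> x y; rewrite mdist_vertex /vdist.
  have h1 : (dist (f (round x)) (f (round y)))%:R <= N%:R * (dist (round x) (round y))%:R :> R.
    by rewrite -natrM ler_nat.
  have h2 : (dist (round x) (round y))%:R <=
      N%:R * (dist (f (round x)) (f (round y)))%:R + N%:R :> R.
    by rewrite -natrM -natrD ler_nat.
  have h3 := dist_round x y; have h4 := mdist_round x y; have h5 := mdist_ge0 x y.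
  set d := (dist (round x) (round y))%:R in h1 h2 h3 h4.
  set e := (dist (f (round x)) (f (round y)))%:R in h1 h2 *.
  have e0 : 0 <= e by exact: ler0n.
  apply/andP; split; last by nra.
  rewrite lerBlDr ler_pdivrMl; last by lra.
  by nra.
move=> y; have [s ys] := f_onto (round y); exists (vertex_point R s).
have h1 := roundP y; have h2 := roundP (vertex_point R s).
rewrite mdist_vertex /vdist in h2.
have h3 : (dist (f s) (f (round (vertex_point R s))))%:R <= N%:R :> R.
  rewrite ler_nat; apply: leq_trans (f_lipschitz _ _) _.
  by rewrite -{2}(muln1 N) leq_mul2l -(ler_nat R) h2 orbT.
have h4 : (dist (round y) (f s))%:R <= N%:R :> R by rewrite ler_nat.
have h5 := metric_triangle y (vertex_point R (round y)) (tree_map (vertex_point R s)).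
have h6 := metric_triangle (vertex_point R (round y)) (vertex_point R (f s))
  (tree_map (vertex_point R s)).
rewrite !mdist_vertex /vdist in h5 h6; lra.
Qed.

End TreeMap.

Theorem theorem1 (R : realType) (T : simplicial_tree) (G : groupType)
    (A : G -> realization R T -> realization R T) :
  bounded_valence T -> bushy R T -> quasi_action A -> cobounded A ->
  exists (T' : simplicial_tree) (A' : G -> realization R T' -> realization R T')
         (f : realization R T' -> realization R T),
    [/\ bounded_valence T', bushy R T',
        isometric_action A' & quasiconjugacy A' A f].
Proof.
move=> bvT [D bushT] qA cA; have [v0] := tree_nonempty T.
have [x0 /branchingP [w1 [w2 [w3 [[w12 w13 w23] [a1 a2 a3]]]]] _] := bushT (vertex_point R v0).
have [N [q1 q2 q3 q4]] := vertex_action_quasi qA cA.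
have [S [sact [f [M [[bvS bS s1 sM sadj] [f1 f2 f3 f4]]]]]] :=
  quasi_action_tree bvT q1 q2 q3 q4 w12 w13 w23 a1 a2 a3.
exists S, (induced s1 sM sadj), (tree_map f); split => //.
- exists (M%:R + 1) => x; have [t bt st] := bS (round x).
  exists t; first exact/branchingP.
  have := metric_triangle x (vertex_point R (round x)) (vertex_point R t).
  have := roundP x; rewrite mdist_vertex /vdist.
  have : (dist (round x) t)%:R <= M%:R :> R by rewrite ler_nat.
  by lra.
- exact: induced_isometry.
split; first exact: tree_map_quasi_isometry f1 f2 f3.
have iso := induced_isometry R s1 sM sadj.
exists ((M * 4)%:R + M%:R + 1) => g x; set y := induced _ _ _ g x.
have gx : mdist y (vertex_point R (sact g (round x))) <= 1.
  by have [_ _ i] := iso; rewrite -(induced_vertex R s1 sM sadj) /y i; exact: roundP.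
have h1 : (dist (f (round y)) (f (sact g (round x))))%:R <= (M * 4)%:R :> R.
  rewrite ler_nat; apply: leq_trans (f1 _ _) _; rewrite leq_mul2l; apply/orP; right.
  rewrite -(ler_nat R).
  have := metric_triangle (vertex_point R (round y)) y (vertex_point R (sact g (round x))).
  have := roundP y; rewrite (metric_sym _ y) mdist_vertex /vdist.
  by move: gx; lra.
have h2 : (dist (f (sact g (round x))) (vertex_action A g (f (round x))))%:R <= M%:R :> R.
  by rewrite ler_nat; exact: f4.
have h3 := roundP (A g (tree_map f x)).
have h4 := metric_triangle (tree_map f y)
  (vertex_point R (vertex_action A g (f (round x)))) (A g (tree_map f x)).
have h5 := dist_tri (f (sact g (round x))) (f (round y)) (vertex_action A g (f (round x))).
rewrite -(ler_nat R) natrD in h5.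
rewrite metric_sym in h3; rewrite mdist_vertex /vdist in h4.
by move: h4; rewrite {1}/tree_map /vertex_action in h1 h2 h3 h5 *; lra.
Qed.
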